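(* Let $V$ be an $n$-dimensional vector space over the field $\mathbb{F}_q$ of order $q$ and let $n,a,b,t$ be positive integers with $n\geq 4$, $a,b\geq 2$, $t<\min\{a,b\}$, $a+b<n+t$, and $\genfrac{[}{]}{0pt}{}{n}{a}_q\leq \genfrac{[}{]}{0pt}{}{n}{b}_q$. If $\mathcal{A}\subset \genfrac{[}{]}{0pt}{}{V}{a}$ and $\mathcal{B}\subset \genfrac{[}{]}{0pt}{}{V}{b}$ are cross-$t$-intersecting, then \[ |\mathcal{A}|+|\mathcal{B}|\leq \genfrac{[}{]}{0pt}{}{n}{b}_q-\sum_{i=0}^{t-1}q^{(a-i)(b-i)}\genfrac{[}{]}{0pt}{}{a}{i}_q\genfrac{[}{]}{0pt}{}{n-a}{b-i}_q+1. \] Moreover, equality holds if and only if $\mathcal{A}=\{A\}$ and $\mathcal{B}=\genfrac{[}{]}{0pt}{}{V}{b}\setminus N(A)$ where $A\in \genfrac{[}{]}{0pt}{}{V}{a}$, or $\mathcal{A}=\genfrac{[}{]}{0pt}{}{V}{b}\setminus N(B)$ and $\mathcal{B}=\{B\}$ where $B\in \genfrac{[}{]}{0pt}{}{V}{b}$, subject to $\genfrac{[}{]}{0pt}{}{n}{a}_q=\genfrac{[}{]}{0pt}{}{n}{b}_q$.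
   Context: For a vector space $V$ over $\mathbb{F}_q$, $\genfrac{[}{]}{0pt}{}{V}{k}$ denotes the set of all $k$-dimensional subspaces of $V$, and $\genfrac{[}{]}{0pt}{}{n}{k}_q=\prod_{i=0}^{k-1}\frac{q^{n-i}-1}{q^{k-i}-1}$ is the Gaussian binomial coefficient (the number of $k$-dimensional subspaces of an $n$-dimensional space over $\mathbb{F}_q$). Families $\mathcal{A},\mathcal{B}$ of subspaces are cross-$t$-intersecting if $\dim(A\cap B)\geq t$ for all $A\in\mathcal{A}$, $B\in\mathcal{B}$. For $A\in\genfrac{[}{]}{0pt}{}{V}{a}$, $N(A)=\{T\in\genfrac{[}{]}{0pt}{}{V}{b}:\dim(T\cap A)<t\}$, and for $B\in\genfrac{[}{]}{0pt}{}{V}{b}$, $N(B)=\{S\in\genfrac{[}{]}{0pt}{}{V}{a}:\dim(S\cap B)<t\}$ (neighbourhoods in the bipartite graph on $\genfrac{[}{]}{0pt}{}{V}{a}\cup\genfrac{[}{]}{0pt}{}{V}{b}$ where $S,T$ are adjacent iff $\dim(S\cap T)<t$).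
   Formalization: Both families are assumed non-empty (with an empty first family and all b-dimensional subspaces as the second, the stated bound fails), and in the second extremal case the first family is the set of a-dimensional subspaces minus N(B), correcting the printed b. *)

(* Defs.v *)
From HB Require Import structures.
From mathcomp Require Import all_boot all_order all_algebra.

Set Implicit Arguments.
Unset Strict Implicit.
Unset Printing Implicit Defensive.

Import GRing.Theory VectorInternalTheory.
Local Open Scope ring_scope.

(* A subspace of a finite-dimensional space over a finite field is encoded by a
   matrix with entries in that field, so there are finitely many of them. *)
HB.instance Definition _ (F : finFieldType) (V : vectType F) :=
  [Countable of {vspace V} by <:].
HB.instance Definition _ (F : finFieldType) (V : vectType F) :=
  [Finite of {vspace V} by <:].

(* The subtraction n - i is truncated; this is harmless, since for k > n the
   product contains the factor i = n, which is 0. *)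
Definition gauss_binom (q n k : nat) : rat :=
  \prod_(i < k) ((q%:R ^+ (n - i) - 1) / (q%:R ^+ (k - i) - 1)).

Definition subspaces (F : finFieldType) (V : vectType F) (k : nat) :
    {set {vspace V}} :=
  [set U : {vspace V} | \dim U == k].

Definition cross_intersecting (F : finFieldType) (V : vectType F) (t : nat)
    (cA cB : {set {vspace V}}) : Prop :=
  forall A B : {vspace V}, A \in cA -> B \in cB -> (t <= \dim (A :&: B))%N.

(* The neighbourhood of U on the side of the bipartite graph made of the
   k-dimensional subspaces: N(A) is nbhd t b A, and N(B) is nbhd t a B. *)
Definition nbhd (F : finFieldType) (V : vectType F) (t k : nat)
    (U : {vspace V}) : {set {vspace V}} :=
  [set T in subspaces V k | (\dim (T :&: U) < t)%N].

(* Main.v *)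
Require Import Defs.
From mathcomp Require Import all_boot all_order all_algebra all_fingroup all_field zify ring.

(** Let two subspaces be related when they meet in dimension at least [t].
    Maximal pairs (P, common neighbours of P) of this bipartite relation can be
    uncrossed: if two of them meet in P, the intersection and the union are
    again maximal, unless the union is too large. Take a maximal pair that is
    nontrivial on both sides, with smallest possible side A, of size m. By
    uncrossing, two distinct translates of A under the automorphism group (the
    "lines") share at most one point, and a maximal P grows by m - 1 points each
    time a line tangent to it is added. Counting the tangent lines along this
    growth forces exactly two lines through every point, whose union is the
    neighbourhood of a single vertex; that vertex is fixed by the stabilizer of
    the point, hence is the same subspace. Then all subspaces adjacent to a
    given one (meeting it in a hyperplane) lie on one line, and connectivity of
    the Grassmann graph puts everything on one line, a contradiction. So every
    maximal pair is a singleton together with its neighbourhood, and the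
    neighbourhoods are counted by a recursion on flags. *)

Set Implicit Arguments.
Unset Strict Implicit.
Unset Printing Implicit Defensive.
Import GRing.Theory Num.Theory.

(** * Maximal pairs in a bipartite relation *)

Definition common_nbrs (X Y : finType) (R : X -> Y -> bool) (P : {set X}) :
    {set Y} :=
  [set y | [forall x in P, R x y]].

Definition nbrs_of (X Y : finType) (R : X -> Y -> bool) (y : Y) : {set X} :=
  [set x | R x y].

Definition graph_aut (X Y : finType) (R : X -> Y -> bool)
    (s : {perm X}) (s' : {perm Y}) : bool :=
  [forall x, forall y, R (s x) (s' y) == R x y].

(** Used with [alpha] an upper bound for this sum over all [P] with both parts nonempty; fragments
    are then the pairs attaining the maximum. *)
Definition fragment (X Y : finType) (R : X -> Y -> bool) (alpha : nat)
    (P : {set X}) : bool :=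
  [&& P != set0, common_nbrs R P != set0
    & #|P| + #|common_nbrs R P| == alpha].

Definition transitive_aut (X Y : finType) (R : X -> Y -> bool) : Prop :=
  forall x x' : X, exists s s', graph_aut R s s' /\ s x = x'.

(** [U] ranges over blocks of imprimitivity: nonempty proper sets equal to every translate that they
    meet. *)
Definition primitive_aut (X Y : finType) (R : X -> Y -> bool) : Prop :=
  forall U : {set X}, U != set0 -> U != setT ->
    (forall s s', graph_aut R s s' -> s @: U :&: U != set0 -> s @: U = U) ->
  #|U| = 1.

(** The configuration that a nontrivial fragment forces and that the Grassmannian refutes. The last
    clause is what later identifies [y] from [x]. *)
Definition two_line_structure (X Y : finType) (R : X -> Y -> bool)
    (L : {set {set X}}) : Prop :=
  [/\ setT \notin L,
      (forall l l', l \in L -> l' \in L -> l != l' -> #|l :&: l'| <= 1) &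
      forall x, exists l1 l2 y,
        [/\ [/\ l1 \in L, l2 \in L, x \in l1 & x \in l2],
            l1 :|: l2 = nbrs_of R y,
            (forall l, l \in L -> x \in l -> l = l1 \/ l = l2) &
            (forall s s', graph_aut R s s' -> s x = x -> s' y = y)]].

(** * Fragments and uncrossing *)

Section Fragments.
Variables (X Y : finType) (R : X -> Y -> bool) (alpha : nat).
Local Notation C := (common_nbrs R).
Local Notation FY := (nbrs_of R).
Local Notation frag := (fragment R alpha).

Lemma common_nbrsP (P : {set X}) y :
  reflect (forall x, x \in P -> R x y) (y \in C P).
Proof. by rewrite inE; apply: (iffP forall_inP). Qed.

Lemma common_nbrsU (P P' : {set X}) : C (P :|: P') = C P :&: C P'.
Proof.
apply/setP=> y; rewrite in_setI; apply/common_nbrsP/andP.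
  by move=> h; split; apply/common_nbrsP=> x xP; apply: h; rewrite inE xP ?orbT.
by case=> /common_nbrsP h /common_nbrsP h' x; rewrite inE => /orP[/h|/h'].
Qed.

Lemma common_nbrs_anti (P P' : {set X}) : P \subset P' -> C P' \subset C P.
Proof.
move=> /subsetP sP; apply/subsetP=> y /common_nbrsP h.
by apply/common_nbrsP=> x /sP/h.
Qed.

Lemma graph_autP (s : {perm X}) (s' : {perm Y}) : reflect (forall x y, R (s x) (s' y) = R x y) (graph_aut R s s').
Proof. by apply: (iffP 'forall_forallP) => h x y; apply/eqP. Qed.

Lemma graph_aut1 : graph_aut R 1%g 1%g.
Proof. by apply/graph_autP=> x y; rewrite !perm1. Qed.

Lemma graph_autM s s' u u' : graph_aut R s s' -> graph_aut R u u' -> graph_aut R (s * u)%g (s' * u')%g.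
Proof. by move=> /graph_autP h /graph_autP k; apply/graph_autP=> x y; rewrite !permM k h. Qed.

Lemma graph_autV s s' : graph_aut R s s' -> graph_aut R s^-1%g s'^-1%g.
Proof. by move=> /graph_autP h; apply/graph_autP=> x y; rewrite -h !permKV. Qed.

Lemma common_nbrs_aut s s' (P : {set X}) : graph_aut R s s' -> C (s @: P) = s' @: C P.
Proof.
move=> /graph_autP h; apply/setP=> y; rewrite -[y](permKV s').
rewrite mem_imset; last exact: perm_inj.
apply/common_nbrsP/common_nbrsP=> k x xP; first by rewrite -h k ?imset_f.
by case/imsetP: xP => z zP ->; rewrite h k.
Qed.

Lemma fragment_aut s s' (P : {set X}) : graph_aut R s s' -> frag P -> frag (s @: P).
Proof.
move=> h; rewrite /fragment (common_nbrs_aut _ h).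
rewrite !card_imset; try exact: perm_inj.
by rewrite !imset_eq0.
Qed.

Hypothesis alpha_max :
  forall P : {set X}, P != set0 -> C P != set0 -> #|P| + #|C P| <= alpha.

(** Submodularity: [C P :|: C P'] lies in the partner of the intersection and [C P :&: C P'] is the
    partner of the union, so the two new sums total at least [2 * alpha] and both must be maximal.
    The size bound serves to make [C (P :|: P')] nonempty. *)
Lemma uncross P P' : frag P -> frag P' -> P :&: P' != set0 ->
  #|P :|: P'| < alpha -> frag (P :&: P') /\ frag (P :|: P').
Proof.
move=> /and3P[P0 CP0 /eqP cP] /and3P[P'0 CP'0 /eqP cP'] I0 Ua.
have cI := alpha_max I0.
have sub : C P :|: C P' \subset C (P :&: P').
  by rewrite subUset !common_nbrs_anti ?subsetIl ?subsetIr.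
have CI0 : C (P :&: P') != set0.
  have [y yC] := set0Pn _ CP0; apply/set0Pn; exists y.
  by apply: (subsetP sub); rewrite inE yC.
move: (cI CI0) (subset_leq_card sub) (cardsUI P P') (cardsUI (C P) (C P')).
move=> {}cI csub c1 c2.
have CU0 : C (P :|: P') != set0.
  rewrite common_nbrsU; apply/negP=> /eqP e; rewrite e cards0 in c2; lia.
have U0 : P :|: P' != set0.
  by have [y yC] := set0Pn _ P0; apply/set0Pn; exists y; rewrite inE yC.
have cU := alpha_max U0 CU0; rewrite common_nbrsU in cU.
by rewrite /fragment I0 CI0 U0 CU0 common_nbrsU /=; split; apply/eqP; lia.
Qed.

(** If [FY y] were strictly larger than [P], then, [y] being one of its common neighbours, its sum
    would exceed [alpha]. *)
Lemma fragment_nbrs P y : frag P -> #|C P| = 1 -> y \in C P -> FY y = P.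
Proof.
move=> /and3P[P0 CP0 /eqP cP] c1 yC; apply/eqP; rewrite eq_sym eqEcard.
have sP : P \subset FY y.
  by apply/subsetP=> x xP; rewrite inE; apply: (common_nbrsP _ _ yC).
rewrite sP /=.
have yCF : y \in C (FY y) by apply/common_nbrsP=> x; rewrite inE.
have F0 : FY y != set0.
  by have [x xP] := set0Pn _ P0; apply/set0Pn; exists x; apply: (subsetP sP).
have CF0 : C (FY y) != set0 by apply/set0Pn; exists y.
have := alpha_max F0 CF0; have : 0 < #|C (FY y)| by rewrite card_gt0.
lia.
Qed.

End Fragments.

(** * Lines: the translates of a smallest nontrivial fragment *)

Section MinimalFragment.
Variables (X Y : finType) (R : X -> Y -> bool) (alpha : nat).
Local Notation C := (common_nbrs R).
Local Notation FY := (nbrs_of R).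
Local Notation frag := (fragment R alpha).
Hypothesis alpha_max :
  forall P : {set X}, P != set0 -> C P != set0 -> #|P| + #|C P| <= alpha.
Hypothesis transX : transitive_aut R.
Hypothesis primX : primitive_aut R.
Hypothesis nonfull : forall y, exists x, ~~ R x y.
Hypothesis second_separator :
  forall x x' y, R x y -> ~~ R x' y -> exists2 y', y' != y & R x y' && ~~ R x' y'.

Variable A : {set X}.
Hypothesis fragA : frag A.
Hypothesis A_gt1 : 1 < #|A|.
Hypothesis A_le : #|A| <= #|C A|.
Hypothesis A_min :
  forall P, frag P -> 1 < #|P| -> 1 < #|C P| -> #|A| <= #|P| /\ #|A| <= #|C P|.

Local Notation m := #|A|.

Definition lines : {set {set X}} :=
  [set l | [exists s, [exists s', graph_aut R s s' && (l == s @: A)]]].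

Lemma linesP l : reflect (exists s s', graph_aut R s s' /\ l = s @: A) (l \in lines).
Proof.
rewrite inE; apply: (iffP existsP) => [[s /existsP[s' /andP[h /eqP->]]]|].
  by exists s, s'.
by case=> s [s' [h ->]]; exists s; apply/existsP; exists s'; rewrite h eqxx.
Qed.

Lemma A_line : A \in lines.
Proof.
apply/linesP; exists 1%g, 1%g; split; first exact: graph_aut1.
by rewrite -[LHS]imset_id; apply: eq_imset => x; rewrite perm1.
Qed.

Lemma line_aut s s' (l : {set X}) : graph_aut R s s' -> (s @: l \in lines) = (l \in lines).
Proof.
have one u u' k : graph_aut R u u' -> k \in lines -> u @: k \in lines.
  move=> h /linesP[v [v' [hv ->]]]; apply/linesP.
  exists (v * u)%g, (v' * u')%g; split; first exact: graph_autM.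
  by rewrite -imset_comp; apply: eq_imset => x; rewrite permM.
move=> h; apply/idP/idP; last exact: (one _ s').
move=> k; have := one _ _ _ (graph_autV h) k.
by rewrite -imset_comp (eq_imset _ (g := id)) ?imset_id // => x /=; rewrite permK.
Qed.

Lemma fragment_sum P : frag P -> #|P| + #|C P| = alpha.
Proof. by case/and3P=> _ _ /eqP. Qed.

Lemma line_fragment l : l \in lines -> frag l.
Proof. by case/linesP=> s [s' [h ->]]; apply: fragment_aut h _. Qed.

Lemma card_line l : l \in lines -> #|l| = m.
Proof. by case/linesP=> s [s' [h ->]]; rewrite card_imset //; apply: perm_inj. Qed.

(** After uncrossing, an intersection with two or more points would be a fragment nontrivial on both
    sides (its partner contains [C P]) and smaller than [A]. *)
Lemma line_meet (P l : {set X}) : frag P -> 1 < #|C P| -> l \in lines ->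
  P :&: l != set0 -> ~~ (l \subset P) ->
  [/\ #|P :&: l| = 1, frag (P :&: l) & frag (P :|: l)].
Proof.
move=> fP CP2 lL I0 nsub.
have cP := fragment_sum fP; have cA := fragment_sum fragA.
have cl := card_line lL.
(* When [P] is a single point, its partner has [alpha - 1] elements, and [alpha] is at least
   [2 * m]. *)
have CPm : m <= #|C P|.
  case: (ltnP 1 #|P|) => [P2|]; first by case: (A_min fP).
  lia.
have I_lt : #|P :&: l| < m.
  rewrite -cl ltn_neqAle subset_leq_card ?subsetIr // andbT.
  apply: contra nsub => /eqP e; apply/setIidPr/eqP.
  by rewrite eqEcard subsetIr e /=.
have I_gt : 0 < #|P :&: l| by rewrite card_gt0.
have cUI := cardsUI P l.
have [|fI fU] := uncross alpha_max fP (line_fragment lL) I0; first lia.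
split=> //; apply/eqP; rewrite eqn_leq I_gt andbT leqNgt; apply/negP => I2.
case: (A_min fI I2); last lia.
apply: leq_trans CP2 _; apply/subset_leq_card/common_nbrs_anti.
exact: subsetIl.
Qed.

Lemma lines_meet_le (l P : {set X}) : frag P -> 1 < #|C P| -> l \in lines ->
  ~~ (l \subset P) -> #|P :&: l| <= 1.
Proof.
move=> fP CP2 lL ns; case: (eqVneq (P :&: l) set0) => [->|I0].
  by rewrite cards0.
by case: (line_meet fP CP2 lL I0 ns) => ->.
Qed.

Lemma line_partner l : l \in lines -> m <= #|C l|.
Proof.
move=> lL; have := fragment_sum (line_fragment lL).
have := fragment_sum fragA; rewrite (card_line lL); lia.
Qed.

Lemma line_sub (l l' : {set X}) : l \in lines -> l' \in lines -> l \subset l' -> l = l'.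
Proof.
by move=> lL lL' sl; apply/eqP; rewrite eqEcard sl !card_line /=.
Qed.

Lemma lines_meet (l l' : {set X}) : l \in lines -> l' \in lines -> l != l' ->
  #|l :&: l'| <= 1.
Proof.
move=> lL lL' ne; apply: lines_meet_le => //; first exact: line_fragment.
  exact: leq_trans (line_partner lL).
by apply: contra ne => sl; rewrite eq_sym (line_sub lL' lL).
Qed.

Lemma lines_eq (l l' : {set X}) x x' : l \in lines -> l' \in lines -> x != x' ->
  x \in l -> x' \in l -> x \in l' -> x' \in l' -> l = l'.
Proof.
move=> lL lL' ne xl x'l xl' x'l'; apply/eqP; apply: contraT => ne'.
have := lines_meet lL lL' ne'; rewrite leqNgt => /negP[].
rewrite (cardD1 x) (cardD1 x') !inE eq_sym ne; rewrite xl xl' x'l x'l'.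
lia.
Qed.

Lemma line_through x : exists2 l, l \in lines & x \in l.
Proof.
have [z zA] : exists z, z \in A by apply/set0Pn; case/and3P: fragA.
have [s [s' [h <-]]] := transX z x; exists (s @: A); last exact: imset_f.
by rewrite (line_aut _ h) A_line.
Qed.

Lemma fragment_nfull P : frag P -> P != setT.
Proof.
case/and3P=> _ /set0Pn[y yC] _; have [x nx] := nonfull y.
apply: contra nx => /eqP e; apply: (common_nbrsP _ _ _ yC); by rewrite e.
Qed.

Definition line_closed (U : {set X}) : bool :=
  [forall l in lines, (U :&: l == set0) || (l \subset U)].

(** Translates and intersections of line-closed sets are line-closed, so a smallest nonempty proper
    one is a block, hence a single point by primitivity. It would contain a whole line through that
    point, although lines have [m > 1] points. *)
Lemma line_closed_full U : U != set0 -> line_closed U -> U = setT.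
Proof.
move=> U0 cU; apply/eqP; apply: contraT => UT.
pose good (W : {set X}) := [&& W != set0, W != setT & line_closed W].
have gU : good U by rewrite /good U0 UT.
case: (arg_minnP (fun W : {set X} => #|W|) gU) => W /and3P[W0 WT cW] minW.
have W1 : #|W| = 1.
  apply: primX => // s s' h I0; apply/eqP; rewrite eqEcard.
  rewrite card_imset; last exact: perm_inj.
  rewrite leqnn andbT.
  suff /minW le : good (s @: W :&: W).
    apply/setIidPl/eqP; rewrite eqEcard subsetIl /= card_imset //.
    exact: perm_inj.
  apply/and3P; split=> //.
    by apply: contra WT => /eqP e; rewrite -subTset -e subsetIr.
  apply/forall_inP=> l lL; move/forall_inP: cW => cW.
  have := cW l lL; case/orP=> [/eqP e|sl]; first by rewrite -setIA e setI0 eqxx.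
  have [k kL ->] : exists2 k, k \in lines & l = s @: k.
    have e : l = s @: (s^-1%g @: l).
      rewrite -imset_comp (eq_imset _ (g := id)) ?imset_id // => x /=.
      by rewrite permKV.
    by exists (s^-1%g @: l); rewrite ?(line_aut _ (graph_autV h)).
  case/orP: (cW k kL) => [/eqP e|sk].
    have eI : s @: W :&: s @: k = set0.
      by rewrite -(imset0 s) -e imsetI // => ? ? _ _; apply: perm_inj.
    by rewrite setIAC eI set0I eqxx.
  case: (boolP (_ == set0)) => //= e; rewrite subsetI imsetS //=.
  case/set0Pn: e => x; rewrite !inE => /andP[/andP[_ xW] xk].
  have skL : s @: k \in lines by rewrite (line_aut _ h).
  case/orP: (cW _ skL) => // /eqP e.
  by move/setP: e => /(_ x); rewrite !inE xW xk.
case/set0Pn: W0 => x xW.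
have [l lL xl] := line_through x.
case/orP: (forall_inP cW l lL) => [/eqP e|sl].
  by move/setP: e => /(_ x); rewrite !inE xW xl.
by have := subset_leq_card sl; rewrite W1 (card_line lL); lia.
Qed.

Lemma tangent_exists U : U != set0 -> U != setT ->
  exists2 l, l \in lines & (U :&: l != set0) && ~~ (l \subset U).
Proof.
move=> U0 UT; case: (boolP (line_closed U)) => [/(line_closed_full U0) e|].
  by rewrite e eqxx in UT.
by case/forall_inPn=> l lL; rewrite negb_or => h; exists l.
Qed.

Definition pencil (x : X) : {set {set X}} := [set l in lines | x \in l].

Lemma in_pencil x l : (l \in pencil x) = (l \in lines) && (x \in l).
Proof. by rewrite in_set. Qed.

Lemma pencil_aut s s' x : graph_aut R s s' ->
  pencil (s x) = [set s @: (l : {set X}) | l in pencil x].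
Proof.
move=> h; apply/setP=> l; apply/idP/imsetP=> [|[k]]; rewrite !in_pencil.
  case/andP=> lL xl; exists (s^-1%g @: l).
    rewrite in_pencil (line_aut _ (graph_autV h)) lL; apply/imsetP; exists (s x) => //.
    by rewrite permK.
  rewrite -imset_comp (eq_imset _ (g := id)) ?imset_id // => z /=.
  by rewrite permKV.
by case/andP=> kL xk ->; rewrite (line_aut _ h) kL imset_f.
Qed.

Lemma card_pencil x x' : #|pencil x| = #|pencil x'|.
Proof.
have [s [s' [h <-]]] := transX x' x; rewrite (pencil_aut _ h) card_imset //.
by apply: imset_inj; apply: perm_inj.
Qed.

(** [A] is not line-closed, so another line passes through some point of [A]; transitivity carries
    this to every point. *)
Lemma pencil_gt1 x : 1 < #|pencil x|.
Proof.
have A0 : A != set0 by case/and3P: fragA.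
have [l lL /andP[/set0Pn[z]]] := tangent_exists A0 (fragment_nfull fragA).
rewrite inE => /andP[zA zl] ns; rewrite (card_pencil x z).
have ne : A != l by apply: contra ns => /eqP->.
apply: (@leq_trans #|[set A; l]|); first by rewrite cards2 ne.
apply/subset_leq_card/subsetP=> k; rewrite in_set2 in_pencil.
by case/orP=> /eqP->; rewrite ?A_line ?lL ?zA ?zl.
Qed.

(** Two distinct lines through [x] uncross to [[set x]]. *)
Lemma singleton_fragment x : frag [set x].
Proof.
have := pencil_gt1 x; case/card_gt1P=> l [l' []].
rewrite !in_pencil => /andP[lL xl] /andP[lL' xl'] ne.
have xI : x \in l :&: l' by rewrite inE xl.
have I0 : l :&: l' != set0 by apply/set0Pn; exists x.
have ns : ~~ (l' \subset l).
  by apply: contra ne => s; rewrite eq_sym (line_sub lL' lL).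
have Cl : 1 < #|C l| by apply: leq_trans (line_partner lL).
have [/eqP/cards1P[z e] fI _] := line_meet (line_fragment lL) Cl lL' I0 ns.
by move: xI fI; rewrite e inE => /eqP->.
Qed.

(** If [A] were [[set x; x']], comparing the fragments [[set x]] and [A] would leave exactly one
    neighbour of [x] that is not a neighbour of [x'], against [second_separator]. *)
Lemma A_gt2 : 2 < m.
Proof.
rewrite ltn_neqAle A_gt1 andbT; apply/negP=> /eqP/esym/eqP/cards2P[x [x' [ne eA]]].
have cA := fragment_sum fragA; have cx := fragment_sum (singleton_fragment x).
rewrite cards1 in cx; have m2 : m = 2 by rewrite eA cards2 ne.
have eC : C A = C [set x] :&: C [set x'] by rewrite eA common_nbrsU.
have C1 z y : (y \in C [set z]) = R z y.
  by apply/common_nbrsP/idP=> [h|h w /set1P->//]; apply: h; rewrite inE.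
have eD : #|C [set x] :\: C [set x']| = 1.
  have := cardsID (C [set x']) (C [set x]); rewrite -eC; lia.
case/eqP/cards1P: eD => y ey.
have : y \in C [set x] :\: C [set x'] by rewrite ey inE.
rewrite in_setD !C1 => /andP[ny Ry].
have [y' ne' /andP[Ry' ny']] := second_separator Ry ny.
have : y' \in C [set x] :\: C [set x'] by rewrite in_setD !C1 Ry' ny'.
by rewrite ey inE (negPf ne').
Qed.

(** * Growing fragments by tangent lines *)

Definition tangents (P : {set X}) : {set {set X}} :=
  [set l in lines | #|P :&: l| == 1].

Lemma in_tangents P l : (l \in tangents P) = (l \in lines) && (#|P :&: l| == 1).
Proof. by rewrite in_set. Qed.

Lemma tangent_fragment P l : frag P -> 1 < #|C P| -> l \in tangents P ->
  frag (P :|: l) /\ #|P :|: l| = #|P| + (m - 1).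
Proof.
move=> fP CP2; rewrite in_tangents => /andP[lL /eqP c1].
have cl := card_line lL.
have I0 : P :&: l != set0 by rewrite -card_gt0 c1.
have ns : ~~ (l \subset P).
  apply/negP=> s; move: c1; rewrite (setIidPr s) cl; lia.
have [_ _ fU] := line_meet fP CP2 lL I0 ns.
by split=> //; have := cardsUI P l; rewrite c1 cl; lia.
Qed.

(* Each line other than [l] that is not inside [P] meets [P :|: l] in at most
   two points, hence is tangent to it as soon as it meets it. *)
Lemma card_tangents_step P l x0 : frag P -> m < #|C P| -> l \in tangents P ->
  #|tangents P| + (m - 1) * (#|pencil x0| - 1) <= #|tangents (P :|: l)| + 1.
Proof.
move=> fP CPm lT.
have CP2 : 1 < #|C P| by apply: leq_trans CPm; apply: ltnW.
have [fU cU] := tangent_fragment fP CP2 lT.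
have /andP[lL /eqP c1] : (l \in lines) && (#|P :&: l| == 1).
  by rewrite -in_tangents.
have m2 := A_gt2; have sP := fragment_sum fP; have sU := fragment_sum fU.
have CU2 : 1 < #|C (P :|: l)| by lia.
have tangU k : k \in lines -> k != l -> ~~ (k \subset P) ->
    (P :|: l) :&: k != set0 -> k \in tangents (P :|: l).
  move=> kL ne ns I0; rewrite in_tangents kL /=.
  suff ns' : ~~ (k \subset P :|: l) by case: (line_meet fU CU2 kL I0 ns') => ->.
  apply/negP=> /setIidPr; rewrite setIUl => e.
  have := lines_meet_le fP CP2 kL ns; have := lines_meet lL kL.
  rewrite eq_sym => /(_ ne).
  have := cardsUI (P :&: k) (l :&: k); rewrite e (card_line kL); lia.
(* The tangents of [P :|: l] to be counted are the old ones other than [l] and the lines of [Z],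
   which leave [l] at a point outside [P]. *)
pose Z := [set k in lines | (k != l) && ((l :\: P) :&: k != set0)].
have ZP k : k \in Z = [&& k \in lines, k != l & (l :\: P) :&: k != set0].
  by rewrite in_set.
have Znot k : k \in Z -> ~~ (k \subset P).
  rewrite ZP => /and3P[_ _ /set0Pn[p]]; rewrite !inE.
  by case/andP=> /andP[npP _] pk; apply: contra npP => /subsetP/(_ p pk).
have subZ : Z \subset tangents (P :|: l).
  apply/subsetP=> k kZ; have := Znot _ kZ.
  move: kZ; rewrite ZP => /and3P[kL ne /set0Pn[p pI]] ns; apply: tangU => //.
  apply/set0Pn; exists p; move: pI; rewrite !inE.
  by case/andP=> /andP[_ ->] ->; rewrite orbT.
have subT : tangents P :\ l \subset tangents (P :|: l).
  apply/subsetP=> k; rewrite in_setD1 in_tangents => /and3P[ne kL /eqP ck].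
  apply: tangU => //; first by apply/negP=> /setIidPr e; rewrite e card_line in ck; lia.
  have : P :&: k != set0 by rewrite -card_gt0 ck.
  by case/set0Pn=> p; rewrite inE => /andP[pP pk]; apply/set0Pn; exists p; rewrite !inE pP pk.
(* A line in both sets would meet [P :|: l] once in [P] and again in [l :\: P], so it would not be
   tangent to the union. *)
have disj : [disjoint tangents P :\ l & Z].
  apply/pred0P=> k /=; apply/negP=> /andP[]; rewrite in_setD1 in_tangents.
  case/and3P=> ne kL /eqP ck kZ.
  have : k \in tangents (P :|: l) by apply: (subsetP subZ).
  rewrite in_tangents => /andP[_ /eqP ck'].
  move: kZ; rewrite ZP => /and3P[_ _]; rewrite -card_gt0 => gt0.
  have := cardsUI (P :&: k) ((l :\: P) :&: k).
  have -> : (P :&: k) :&: ((l :\: P) :&: k) = set0.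
    by apply/setP=> z; rewrite !inE; case: (z \in P); rewrite /= ?andbF.
  have -> : (P :&: k) :|: ((l :\: P) :&: k) = (P :|: l) :&: k.
    by apply/setP=> z; rewrite !inE; case: (z \in P); rewrite /= ?orbF.
  rewrite cards0; lia.
have cardZ : (m - 1) * (#|pencil x0| - 1) <= #|Z|.
  have cD : #|l :\: P| = m - 1.
    have := cardsID P l; rewrite setIC c1 (card_line lL); lia.
  rewrite -cD.
  (* Count incidences between points of [l :\: P] and lines of [Z]: every point lies on all lines of
     its pencil but [l], and a line of [Z] meets [l] at most once. *)
  have -> : #|l :\: P| * (#|pencil x0| - 1)
          = \sum_(p in l :\: P) \sum_(k in Z) (p \in k).
    rewrite -sum_nat_const; apply: eq_bigr => p; rewrite inE => /andP[pP pl].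
    rewrite -big_mkcondr sum1_card (card_pencil x0 p).
    have lp : l \in pencil p by rewrite in_pencil lL.
    rewrite (cardsD1 l (pencil p)) lp addKn; apply: eq_card => k.
    rewrite in_setD1 in_pencil; transitivity ((k \in Z) && (p \in k)); last by [].
    rewrite ZP; case: (boolP (p \in k)) => pk; last by rewrite !andbF.
    rewrite !andbT; have -> : (l :\: P) :&: k != set0.
      by apply/set0Pn; exists p; rewrite !inE pP pl.
    by rewrite andbT andbC.
  rewrite exchange_big /= -sum1_card; apply: leq_sum => k.
  rewrite ZP => /and3P[kL ne _].
  rewrite -big_mkcondr sum1_card.
  rewrite eq_sym in ne; apply: leq_trans (lines_meet lL kL ne).
  by apply/subset_leq_card/subsetP=> p; rewrite unfold_in /= !inE => /andP[/andP[_ ->]].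
have := cardsUI (tangents P :\ l) Z.
have -> : (tangents P :\ l) :&: Z = set0.
  by apply/eqP; rewrite setI_eq0.
rewrite cards0 addn0 => eU.
have : #|(tangents P :\ l) :|: Z| <= #|tangents (P :|: l)|.
  by apply: subset_leq_card; rewrite subUset subT.
rewrite eU; have := cardsD1 l (tangents P); rewrite lT; lia.
Qed.

(** Adding a tangent [l] leaves exactly one common neighbour, an element of [C P] whose
    neighbourhood is [P :|: l]. It determines [l], since [l] has at least two points outside [P]; so
    tangents inject into [C P]. *)
Lemma card_tangents_le P : frag P -> #|C P| = m -> #|tangents P| <= m.
Proof.
move=> fP CPm; have m2 := A_gt2; have sP := fragment_sum fP.
have CP2 : 1 < #|C P| by rewrite CPm.
have [y0 y0C] : exists y, y \in C P by apply/set0Pn; case/and3P: fP.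
(* The default [y0] is never returned for a tangent [l], as [C (P :|: l)] is then nonempty. *)
pose f (l : {set X}) := odflt y0 [pick y in C (P :|: l)].
have fE l : l \in tangents P ->
    [/\ f l \in C P & nbrs_of R (f l) = P :|: l].
  move=> lT; have [fU cU] := tangent_fragment fP CP2 lT.
  have sU := fragment_sum fU.
  have C1 : #|C (P :|: l)| = 1 by lia.
  have fin : f l \in C (P :|: l).
    rewrite /f; case: pickP => [//|e]; move/eqP/cards1P: C1 => [y eC].
    by have := e y; rewrite eC inE eqxx.
  split; last exact: (fragment_nbrs alpha_max fU C1 fin).
  exact: (subsetP (common_nbrs_anti _ (subsetUl P l))).
rewrite -{1}CPm -(card_in_imset (f := f)).
  apply/subset_leq_card/subsetP=> y /imsetP[l lT ->]; by case: (fE l lT).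
move=> l k lT kT ef; case: (fE l lT) => _ el; case: (fE k kT) => _ ek.
move: lT kT; rewrite !in_tangents => /andP[lL /eqP cl] /andP[kL /eqP ck].
have e : P :|: l = P :|: k by rewrite -el -ek ef.
apply/eqP; apply: contraT => ne; have := lines_meet lL kL ne.
have : #|l :\: P| <= #|l :&: k|.
  apply/subset_leq_card/subsetP=> z; rewrite !inE => /andP[zP zl].
  by move/setP/(_ z): e; rewrite !inE (negPf zP) zl /= => <-.
have := cardsID P l; rewrite setIC cl (card_line lL); lia.
Qed.

(** Grow a fragment from a point by tangents until the partner would drop to size [m]. The lower
    bound of [card_tangents_step] then meets the upper bound [m] of [card_tangents_le], which leaves
    room for only two lines per point and for a single growth step. *)
Lemma pencil2 x : #|pencil x| = 2 /\ alpha = 2 * m.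
Proof.
have m2 := A_gt2; have cA := fragment_sum fragA.
(* The last clause holds for a point or for a set with a third tangent; once pencils have size 2 the
   third tangent is impossible, so the extremal [P] is a point and [alpha = m + m]. *)
pose good P := [&& frag P, m < #|C P|, 1 < #|tangents P|
                 & (#|P| == 1) || (2 < #|tangents P|)].
have g1 : good [set x].
  have fx := singleton_fragment x; have := fragment_sum fx; rewrite cards1 => cx.
  rewrite /good fx cards1 eqxx /= andbT; apply/andP; split; first lia.
  suff -> : tangents [set x] = pencil x by apply: pencil_gt1.
  apply/setP=> l; rewrite in_tangents in_pencil; congr (_ && _).
  case: (boolP (x \in l)) => xl.
    by rewrite (setIidPl _) ?sub1set // cards1.
  suff -> : [set x] :&: l = set0 by rewrite cards0.
  by apply/eqP; rewrite setI_eq0 disjoints1.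
case: (arg_minnP (fun P : {set X} => #|C P|) g1) => P /and4P[fP CPm tP P1or] minP.
have [l lT] : exists l, l \in tangents P.
  by apply/set0Pn; rewrite -card_gt0; apply: leq_trans tP.
have CP2 : 1 < #|C P| by apply: leq_trans CPm; apply: ltnW.
have [fU cU] := tangent_fragment fP CP2 lT.
have step := card_tangents_step x fP CPm lT.
have p2 := pencil_gt1 x; have sP := fragment_sum fP; have sU := fragment_sum fU.
have CU2 : 1 < #|C (P :|: l)| by lia.
have U2 : 1 < #|P :|: l| by lia.
have [_ CUm] := A_min fU U2 CU2.
have CUle : #|C (P :|: l)| <= m.
  (* Otherwise [P :|: l] would be good with a smaller partner: it has at least [2 + (m - 1) - 1]
     tangents, which exceeds 2. *)
  rewrite leqNgt; apply/negP=> gt; suff /minP : good (P :|: l) by lia.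
  rewrite /good fU gt /=; suff t3 : 2 < #|tangents (P :|: l)| by rewrite t3 (ltnW t3) orbT.
  nia.
have tU := card_tangents_le fU (anti_leq (introT andP (conj CUle CUm))).
have r2 : #|pencil x| = 2.
  apply/eqP; rewrite eqn_leq p2 andbT leqNgt; apply/negP=> r3; nia.
rewrite r2 in step; split=> //; case/orP: P1or => [/eqP P1|t3]; lia.
Qed.

(** The two lines through [x] unite to a fragment of size [2 * m - 1], so its partner is one vertex
    [y]. The stabilizer of [x] permutes these two lines, hence preserves their union and fixes
    [y]. *)
Lemma lines_two_line_structure : two_line_structure R lines.
Proof.
have m2 := A_gt2; split.
- by apply/negP=> /line_fragment/fragment_nfull; rewrite eqxx.
- exact: lines_meet.
move=> x; have [/eqP r2 a2] := pencil2 x.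
case/cards2P: r2 => [l1 [l2 [ne ep]]].
have [/andP[l1L xl1] /andP[l2L xl2]] :
    ((l1 \in lines) && (x \in l1)) /\ ((l2 \in lines) && (x \in l2)).
  by rewrite -!in_pencil ep !inE !eqxx orbT.
have only l : l \in lines -> x \in l -> l = l1 \/ l = l2.
  move=> lL xl; have : l \in pencil x by rewrite in_pencil lL.
  by rewrite ep in_set2 => /orP[] /eqP; [left|right].
have f1 := line_fragment l1L; have s1 := fragment_sum f1.
have c1 := card_line l1L.
have C12 : 1 < #|C l1| by lia.
have t2 : l2 \in tangents l1.
  rewrite in_tangents l2L eqn_leq lines_meet //= card_gt0.
  by apply/set0Pn; exists x; rewrite inE xl1.
have [fU cU] := tangent_fragment f1 C12 t2; have sU := fragment_sum fU.
have C1 : #|C (l1 :|: l2)| = 1 by lia.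
have /eqP/cards1P[y ey] := C1.
have yC : y \in C (l1 :|: l2) by rewrite ey inE.
have eF := fragment_nbrs alpha_max fU C1 yC.
exists l1, l2, y; split=> // s s' h sx.
have inv : s @: (l1 :|: l2) = l1 :|: l2.
  have := pencil_aut x h; rewrite sx ep => e.
  have e1 : s @: l1 \in [set l1; l2] by rewrite e imset_f // !inE eqxx.
  have e2 : s @: l2 \in [set l1; l2] by rewrite e imset_f // !inE eqxx orbT.
  apply/eqP; rewrite eqEcard card_imset ?leqnn ?andbT; last exact: perm_inj.
  rewrite imsetU; move: e1 e2; rewrite !in_set2.
  by do 2![case/orP=> /eqP ->]; rewrite ?subUset ?subsetUl ?subsetUr ?subxx.
have : s' y \in C (l1 :|: l2) by rewrite -inv (common_nbrs_aut _ h) imset_f.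
by rewrite ey inE => /eqP.
Qed.

End MinimalFragment.

(** * Exchanging the two sides of the relation *)

Lemma fragment_flip (X Y : finType) (R : X -> Y -> bool) alpha P
    (R' := fun y x => R x y) :
  (forall P : {set X}, P != set0 -> common_nbrs R P != set0 ->
     #|P| + #|common_nbrs R P| <= alpha) ->
  fragment R alpha P ->
  common_nbrs R' (common_nbrs R P) = P /\ fragment R' alpha (common_nbrs R P).
Proof.
move=> amax fP; case/and3P: (fP) => P0 CP0 /eqP cP.
have sub : P \subset common_nbrs R' (common_nbrs R P).
  by apply/subsetP=> x xP; apply/common_nbrsP=> y /common_nbrsP; apply.
(* If the double neighbourhood [Q] were larger than [P], its sum would exceed [alpha], because its
   partner contains that of [P]. *)
have e : common_nbrs R' (common_nbrs R P) = P.
  apply/eqP; rewrite eq_sym eqEcard sub /=.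
  set Q := common_nbrs R' _ in sub *.
  have sub' : common_nbrs R P \subset common_nbrs R Q.
    by apply/subsetP=> y yC; apply/common_nbrsP=> x /common_nbrsP; apply.
  have Q0 : Q != set0 by apply: contra P0 => /eqP eQ; rewrite -subset0 -eQ.
  have CQ0 : common_nbrs R Q != set0.
    by apply: contra CP0 => /eqP eQ; rewrite -subset0 -eQ.
  by have := amax _ Q0 CQ0; have := subset_leq_card sub'; lia.
by split=> //; rewrite /fragment e P0 CP0 addnC cP /=.
Qed.

Theorem fragment_singleton (X Y : finType) (R : X -> Y -> bool) (alpha : nat)
    (R' := fun y x => R x y) :
  (forall P : {set X}, P != set0 -> common_nbrs R P != set0 ->
     #|P| + #|common_nbrs R P| <= alpha) ->
  transitive_aut R -> transitive_aut R' -> primitive_aut R -> primitive_aut R' ->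
  (forall y, exists x, ~~ R x y) -> (forall x, exists y, ~~ R x y) ->
  (forall x x' y, R x y -> ~~ R x' y ->
     exists2 y', y' != y & R x y' && ~~ R x' y') ->
  (forall y y' x, R x y -> ~~ R x y' ->
     exists2 x', x' != x & R x' y && ~~ R x' y') ->
  (forall L, ~ two_line_structure R L) -> (forall L, ~ two_line_structure R' L) ->
  forall P, fragment R alpha P -> #|P| = 1 \/ #|common_nbrs R P| = 1.
Proof.
move=> amax tX tY pX pY nY nX sX sY noX noY P fP.
have amax' Q : Q != set0 -> common_nbrs R' Q != set0 ->
    #|Q| + #|common_nbrs R' Q| <= alpha.
  move=> Q0 CQ0; set P' := common_nbrs R' Q in CQ0 *.
  have sub : Q \subset common_nbrs R P'.
    by apply/subsetP=> y yQ; apply/common_nbrsP=> x /common_nbrsP; apply.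
  have := subset_leq_card sub; have C0 : common_nbrs R P' != set0.
    by apply: contra Q0 => /eqP e; rewrite -subset0 -e.
  by have := amax P' CQ0 C0; lia.
case/and3P: (fP); rewrite -!card_gt0 => P0 CP0 _.
case: (ltnP 1 #|P|) => P1; last by left; lia.
case: (ltnP 1 #|common_nbrs R P|) => CP1; last by right; lia.
exfalso; pose big (Q : {set X}) := [&& fragment R alpha Q, 1 < #|Q| & 1 < #|common_nbrs R Q|].
have bP : big P by rewrite /big fP P1.
(* Minimizing the smaller of the two sides makes the extremal fragment usable as the line [A] either
   in [R] or in [R']. *)
pose size (Q : {set X}) := minn #|Q| #|common_nbrs R Q|.
case: (arg_minnP size bP) => A /and3P[fA A1 CA1] minA.
case: (leqP #|A| #|common_nbrs R A|) => le.
  apply: (noX _ (lines_two_line_structure amax tX pX nY sX fA A1 le _)).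
  move=> Q fQ Q1 CQ1; have /minA : big Q by rewrite /big fQ Q1.
  by rewrite /size; lia.
have [eA fA'] := fragment_flip amax fA.
have le' : #|common_nbrs R A| <= #|common_nbrs R' (common_nbrs R A)|.
  by rewrite eA ltnW.
apply: (noY _ (lines_two_line_structure amax' tY pY nX sY fA' CA1 le' _)).
move=> Q fQ Q1 CQ1; have [eQ fQ'] := fragment_flip amax' fQ.
have /minA : big (common_nbrs R' Q) by rewrite /big fQ' CQ1 /= eQ.
rewrite /size eQ; lia.
Qed.

(** * Degrees and the extremal bound *)

Lemma card_nbrs_const (X Y : finType) (R : X -> Y -> bool)
    (R' := fun y x => R x y) (y y' : Y) : transitive_aut R' ->
  #|nbrs_of R y| = #|nbrs_of R y'|.
Proof.
move=> transY; have [s [s' [/graph_autP h <-]]] := transY y y'.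
rewrite -(card_imset (mem (nbrs_of R y)) (@perm_inj _ s')).
apply: eq_card => x; rewrite inE; apply/imsetP/idP=> [[z]|Rx].
  by rewrite inE => Rz ->; rewrite -/(R' (s y) (s' z)) h.
exists (s'^-1%g x); last by rewrite permKV.
by rewrite inE -/(R' y (s'^-1%g x)) -h permKV.
Qed.

Lemma graph_double_count (X Y : finType) (R : X -> Y -> bool) (R' := fun y x => R x y)
    (x : X) (y : Y) : transitive_aut R -> transitive_aut R' ->
  #|X| * #|nbrs_of R' x| = #|Y| * #|nbrs_of R y|.
Proof.
move=> tX tY.
transitivity (\sum_(x' : X) \sum_(y' : Y) R x' y').
  rewrite -sum_nat_const; apply: eq_bigr => x' _.
  rewrite (@card_nbrs_const Y X R' x x' tX) -sum1_card big_mkcond /=.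
  by apply: eq_bigr => y' _; rewrite inE.
rewrite exchange_big -sum_nat_const; apply: eq_bigr => y' _.
rewrite (@card_nbrs_const X Y R y y' tY) -sum1_card [RHS]big_mkcond /=.
by apply: eq_bigr => x' _; rewrite inE.
Qed.

(** A maximal pair is a vertex with its neighbourhood. Counting edges gives
    [#|X| * f = #|Y| * #|nbrs_of R y|], so with [#|X| <= #|Y|] the vertices of [Y] have degree at
    most [f], and a pair centred at [y] is never better than one centred in [X]. *)
Theorem cross_bound (X Y : finType) (R : X -> Y -> bool) (R' := fun y x => R x y)
    (f : nat) (A : {set X}) (B : {set Y}) :
  transitive_aut R -> transitive_aut R' ->
  (forall alpha,
     (forall P : {set X}, P != set0 -> common_nbrs R P != set0 ->
        #|P| + #|common_nbrs R P| <= alpha) ->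
     forall P, fragment R alpha P -> #|P| = 1 \/ #|common_nbrs R P| = 1) ->
  #|X| <= #|Y| -> (forall x, #|nbrs_of R' x| = f) ->
  A != set0 -> B != set0 -> (forall x y, x \in A -> y \in B -> R x y) ->
  #|A| + #|B| <= f + 1 /\
  (#|A| + #|B| = f + 1 ->
     (exists x, A = [set x] /\ B = nbrs_of R' x) \/
     (#|X| = #|Y| /\ exists y, A = nbrs_of R y /\ B = [set y])).
Proof.
move=> tX tY hfrag XY fE A0 B0 AB.
have [x0 x0A] := set0Pn _ A0; have [y0 y0B] := set0Pn _ B0.
have X0 : 0 < #|X| by apply/card_gt0P; exists x0.
have dc y : #|X| * f = #|Y| * #|nbrs_of R y|.
  by rewrite -(fE x0); apply: graph_double_count.
have le_f y : #|nbrs_of R y| <= f.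
  by have := dc y; nia.
have f0 : 0 < f by rewrite -(fE x0) card_gt0; apply/set0Pn; exists y0; rewrite inE /R' AB.
pose C := common_nbrs R.
have sBC : B \subset C A.
  by apply/subsetP=> y yB; apply/common_nbrsP=> x xA; apply: AB.
have C1 x : C [set x] = nbrs_of R' x.
  apply/setP=> y; rewrite [RHS]inE /R'; apply/common_nbrsP/idP=> [|Rxy x' /set1P-> //].
  by apply; rewrite inE.
have sF (P : {set X}) y : y \in C P -> P \subset nbrs_of R y.
  by move/common_nbrsP=> h; apply/subsetP=> x xP; rewrite inE h.
have CA0 : C A != set0 by apply: contra B0 => /eqP e; rewrite -subset0 -e.
pose ok P := (P != set0) && (C P != set0).
have okA : ok A by rewrite /ok A0.
have amax P : P != set0 -> C P != set0 -> #|P| + #|C P| <= f + 1.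
  case: (arg_maxnP (fun P : {set X} => #|P| + #|C P|) okA) => Q /andP[Q0 CQ0] maxQ P0 CP0.
  apply: leq_trans (maxQ P _) _; first by rewrite /ok P0.
  (* The value at a maximizer [Q] is taken as [alpha], which makes [Q] a fragment. *)
  have [||/eqP/cards1P[x ->]|c1] := hfrag (#|Q| + #|C Q|) _ Q.
  - by move=> P' P'0 CP'0; apply: maxQ; rewrite /ok P'0.
  - by rewrite /fragment Q0 CQ0 /=.
  - by rewrite C1 fE cards1 addnC.
  have [y yC] := set0Pn _ CQ0.
  rewrite /C c1 leq_add2r; apply: leq_trans (le_f y).
  exact/subset_leq_card/sF.
have cA := amax A A0 CA0; have cB := subset_leq_card sBC.
split=> [|eAB]; first by rewrite (leq_trans _ cA) ?leq_add2l.
have eB : B = C A.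
  by apply/eqP; rewrite eqEcard sBC -(leq_add2l #|A|) eAB.
have fA : fragment R (f + 1) A.
  by rewrite /fragment A0 CA0 /= -/(C A) -eB eAB.
case: (hfrag _ amax A fA) => [/eqP/cards1P[x eA]|c1].
  by left; exists x; rewrite eB eA C1.
right; have /eqP/cards1P[y ey] := c1.
have yC : y \in C A by rewrite /C ey inE.
have eF : A = nbrs_of R y.
  apply/eqP; rewrite eqEcard sF //=; apply: leq_trans (le_f y) _.
  by move: eAB; rewrite eB /C c1; lia.
have cF : #|nbrs_of R y| = f by move: eAB; rewrite eB /C c1 -eF; lia.
split; last by exists y; rewrite eB.
by have := dc y; rewrite cF => /eqP; rewrite eqn_pmul2r // => /eqP.
Qed.

Local Open Scope ring_scope.

(** * Linear algebra of subspaces *)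

Section Subspaces.
Variables (F : fieldType) (V : vectType F).
Implicit Types (U W S T C : {vspace V}) (u v w x y : V).

(** Both families are completed to bases; the linear map matching the bases is onto, hence injective
    by dimension. *)
Lemma free_automorphism (X X' : seq V) :
  free X -> free X' -> size X = size X' ->
  exists2 g : 'End(V), lker g == 0%VS & map g X = X'.
Proof.
have ext (Z : seq V) : free Z -> exists2 Z', basis_of fullv (Z ++ Z') & size Z' = (\dim {:V} - size Z)%N.
  move=> fZ; exists (vbasis <<Z>>^C).
    rewrite basisEdim span_cat (span_basis (vbasisP _)) addv_complf subvv /=.
    rewrite size_cat size_tuple dimv_compl (eqP fZ).
    by have := dimvS (subvf <<Z>>); rewrite (eqP fZ); lia.
  by rewrite size_tuple dimv_compl (eqP fZ).
move=> fX fX' sXX'; have [Z bZ sZ] := ext X fX; have [Z' bZ' sZ'] := ext X' fX'.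
have [f hf] := linear_of_free (X ++ Z) (X' ++ Z').
have mf : map f (X ++ Z) = X' ++ Z'.
  by apply: hf; [exact: basis_free bZ|rewrite !size_cat sZ sZ' sXX'].
have mg : map (linfun f) (X ++ Z) = X' ++ Z'.
  by rewrite -mf; apply: eq_map => z; rewrite lfunE.
exists (linfun f).
  have : limg (linfun f) = fullv.
    by rewrite -(span_basis bZ) limg_span mg (span_basis bZ') (span_basis bZ).
  move=> e; have := limg_ker_dim (linfun f) fullv.
  by rewrite e capfv -dimv_eq0; lia.
by move: mg; rewrite map_cat => /eqP; rewrite eqseq_cat ?size_map // => /andP[/eqP].
Qed.

Lemma limg_id_on (g : 'End(V)) U : (forall v, v \in U -> g v = v) -> (g @: U)%VS = U.
Proof.
move=> h; apply/vspaceP=> v; apply/memv_imgP/idP => [[u uU ->]|vU].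
  by rewrite h.
by exists v; rewrite ?h.
Qed.

Lemma automorphism_fix_move W x x' : x \notin W -> x' \notin W ->
  exists g : 'End(V),
    [/\ lker g == 0%VS, forall v, v \in W -> g v = v & g x = x'].
Proof.
move=> xW x'W.
have fr z : z \notin W -> free (z :: vbasis W).
  by rewrite free_cons (span_basis (vbasisP _)) (basis_free (vbasisP _)) andbT.
have [g kg /= [gx gW]] := free_automorphism (fr x xW) (fr x' x'W) erefl.
exists g; split=> // v; rewrite -{1}(span_basis (vbasisP W)).
have idW z : z \in (vbasis W : seq V) -> g z = z.
  move=> zW; have := congr1 (fun s => nth 0 s (index z (vbasis W))) gW.
  by rewrite (nth_map 0) ?index_mem // nth_index.
move=> /coord_span ev; rewrite [in RHS]ev {1}ev linear_sum; apply: eq_bigr => i _.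
by rewrite linearZ /= idW // mem_nth // size_tuple.
Qed.

Lemma dim_add_line C w : w \notin C -> \dim (C + <[w]>) = (\dim C).+1.
Proof.
move=> wC; have w0 : w != 0 by apply: contraNneq wC => ->; rewrite mem0v.
rewrite dimv_disjoint_sum ?dim_vline ?w0 ?addn1 //.
apply/eqP; rewrite -subv0; apply/subvP=> v.
rewrite memv_cap => /andP[vC /vlineP[k e]]; move: vC.
by rewrite e rpredZeq (negPf wC) orbF => /eqP->; rewrite scale0r mem0v.
Qed.

Lemma subspace_between U W k : (U <= W)%VS -> (\dim U <= k <= \dim W)%N ->
  exists T, [/\ (U <= T)%VS, (T <= W)%VS & \dim T = k].
Proof.
move=> sUW /andP[]; elim: k => [|k IH] Uk kW.
  by exists U; split=> //; lia.
have [e|ne] := eqVneq (\dim U) k.+1; first by exists U.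
have [||T [UT TW dT]] := IH; [lia|lia|].
have /subvPn[w wW wT] : ~~ (W <= T)%VS.
  by apply/negP=> /dimvS; lia.
exists (T + <[w]>)%VS; split; last by rewrite dim_add_line ?dT.
  exact: subv_trans UT (addvSl _ _).
by rewrite subv_add TW -memvE.
Qed.

(** No space is the union of two proper subspaces: if neither [u] nor [w] works, their sum does. *)
Lemma avoid_two S U W : ~~ (S <= U)%VS -> ~~ (S <= W)%VS ->
  exists v, [/\ v \in S, v \notin U & v \notin W].
Proof.
move=> /subvPn[u uS uU] /subvPn[w wS wW].
have [uW|] := boolP (u \in W); last by exists u.
have [wU|] := boolP (w \in U); last by exists w.
exists (u + w); split; first exact: memvD.
  by rewrite rpredDr.
by rewrite rpredDl.
Qed.

Lemma cap_add_line C S w : (C <= S)%VS -> w \notin S -> (S :&: (C + <[w]>))%VS = C.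
Proof.
move=> sCS wS; apply/eqP; rewrite eqEsubv subv_cap sCS addvSl !andbT.
apply/subvP=> v; rewrite memv_cap => /andP[vS /memv_addP[c cC [u /vlineP[k ->] e]]].
have cS := subvP sCS _ cC; move: vS; rewrite e (rpredDl _ cS) rpredZeq (negPf wS) orbF => /eqP->.
by rewrite scale0r addr0.
Qed.

Lemma hyperplane_avoiding S U x : (U <= S)%VS -> x \in S -> x \notin U ->
  exists C, [/\ (U <= C)%VS, (C <= S)%VS, x \notin C & (\dim C).+1 = \dim S].
Proof.
move=> sUS xS xU; pose W := (U + <[x]>)%VS; pose C := (U + (S :\: W))%VS.
have sWS : (W <= S)%VS by rewrite subv_add sUS -memvE.
have sCS : (C <= S)%VS by rewrite subv_add sUS diffvSl.
have eS : (C + <[x]>)%VS = S.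
  by rewrite /C (addvC U) -addvA -[RHS](addv_diff_cap S W) (capv_idPr sWS).
have dS := dimv_cap_compl S W; rewrite (capv_idPr sWS) dim_add_line // in dS.
have dC : (\dim C < \dim S)%N.
  by have := dimv_sum_cap U (S :\: W); rewrite -/C; lia.
have xC : x \notin C.
  apply: contraL dC => xC; have eC : (C + <[x]>)%VS = C by apply/addv_idPl.
  by rewrite -{1}eS eC ltnn.
by exists C; rewrite addvSl sCS xC -eS dim_add_line.
Qed.

Lemma dim_cap_hyper H T U : (H <= T)%VS ->
  (\dim (T :&: U) + \dim H <= \dim T + \dim (H :&: U))%N.
Proof.
move=> sHT; have eI : (T :&: U :&: H)%VS = (H :&: U)%VS.
  by rewrite (capvC T) -capvA (capv_idPr sHT) capvC.
rewrite -(dimv_sum_cap (T :&: U) H) eI leq_add2r.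
by apply: dimvS; rewrite subv_add capvSl.
Qed.

Lemma dim_cap_lt S S1 k : \dim S = k -> \dim S1 = k -> S != S1 ->
  (\dim (S :&: S1) < k)%N.
Proof.
move=> dS dS1; apply: contraNltn => le.
have e1 : (S :&: S1)%VS = S by apply/eqP; rewrite eqEdim capvSl dS.
have e2 : (S :&: S1)%VS = S1 by apply/eqP; rewrite eqEdim capvSr dS1.
by rewrite -{1}e1 e2.
Qed.

Lemma not_sub S S1 k : \dim S = k -> \dim S1 = k -> S != S1 -> ~~ (S <= S1)%VS.
Proof. by move=> dS dS1; apply: contra => le; rewrite eqEdim le dS dS1 /=. Qed.

Lemma adjacent_decomp S S1 : \dim S = \dim S1 -> (\dim (S :&: S1)).+1 = \dim S ->
  exists s, [/\ s \in S, s \notin S1 & S = ((S :&: S1) + <[s]>)%VS].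
Proof.
move=> dS dI.
have /subvPn[s sS sS1] : ~~ (S <= S1)%VS.
  by apply/negP=> /capv_idPl e; move: dI; rewrite e; lia.
exists s; split=> //; apply/eqP; rewrite eq_sym eqEdim subv_add capvSl -memvE sS /=.
rewrite dim_add_line ?dI //; by rewrite memv_cap (negPf sS1) andbF.
Qed.

(** A basis of the intersection, plus one vector from each of the two subspaces, is a free family
    that determines both; two such families are matched by an automorphism. *)
Lemma adjacent_automorphism S S1 S2 :
  \dim S1 = \dim S -> \dim S2 = \dim S ->
  (\dim (S :&: S1)).+1 = \dim S -> (\dim (S :&: S2)).+1 = \dim S ->
  exists g : 'End(V), [/\ lker g == 0%VS, (g @: S)%VS = S & (g @: S1)%VS = S2].
Proof.
have aux T : \dim T = \dim S -> (\dim (S :&: T)).+1 = \dim S ->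
    exists s w, [/\ S = ((S :&: T) + <[s]>)%VS, T = ((S :&: T) + <[w]>)%VS
                  & free (w :: s :: vbasis (S :&: T))].
  move=> dT dI; have [s [sS sT eS]] := adjacent_decomp (esym dT) dI.
  have [||w [wT wS eT]] := @adjacent_decomp T S => //; first by rewrite capvC dI.
  exists s, w; split=> //; first by rewrite capvC.
  rewrite !free_cons span_cons !(span_basis (vbasisP _)) (basis_free (vbasisP _)).
  by rewrite addvC -eS wS memv_cap (negPf sT) andbF.
move=> d1 d2 a1 a2; have [s [w [eS e1 fr]]] := aux S1 d1 a1.
have [s' [w' [eS' e2 fr']]] := aux S2 d2 a2.
have [|g kg /= [gw gs gI]] := free_automorphism fr fr'.
  by rewrite /= !size_tuple; congr _.+2; lia.
have eI : (g @: (S :&: S1) = S :&: S2)%VS.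
  by rewrite -(span_basis (vbasisP (S :&: S1))) limg_span gI (span_basis (vbasisP _)).
exists g; split=> //.
  by rewrite {1}eS limgD eI limg_line gs -eS'.
by rewrite e1 limgD eI limg_line gw -e2.
Qed.

(** The stabilizer of [S] leaves only the zero space, [S] and [fullv] invariant. A vector of [T]
    outside [S] could be moved out of [T] with [S] fixed pointwise; if [T] were proper in [S], some
    [y] in [T] could be moved within [S] to some [v] outside [T]. *)
Lemma fixed_by_stabilizer S T : T != 0%VS -> T != fullv -> S != fullv ->
  (forall g : 'End(V), lker g == 0%VS -> (g @: S)%VS = S -> (g @: T)%VS = T) ->
  T = S.
Proof.
move=> T0 TV SV h; apply/eqP; rewrite eqEsubv.
have sTS : (T <= S)%VS.
  apply/negPn/negP=> /subvPn[y yT yS].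
  have [||w [_ wT wS]] := @avoid_two fullv T S; rewrite -?eqEsubv ?subvf //.
  - by apply: contra TV => sT; rewrite eqEsubv subvf.
  - by apply: contra SV => sT; rewrite eqEsubv subvf.
  have [g [kg gS gy]] := automorphism_fix_move yS wS.
  by have := memv_img g yT; rewrite (h g kg (limg_id_on gS)) gy (negPf wT).
rewrite sTS /=; apply/negPn/negP=> /subvPn[v vS vT].
have yT := memv_pick T; set y := vpick T in yT.
have y0 : y != 0 by rewrite vpick0.
have yS := subvP sTS _ yT.
(* [H] contains [y - v] but not [y], hence not [v] either; so an automorphism can fix [H] and send
   [y] to [v], and it preserves [S]. *)
have [|||H [sH sHS yH dH]] := @hyperplane_avoiding S <[y - v]>%VS y.
- by rewrite -memvE rpredB.
- by [].
- apply/negP=> /vlineP[k e].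
  have : k *: v \in T.
    have -> : k *: v = k *: y - y by rewrite {2}e scalerBr opprB addrC subrK.
    by rewrite rpredB ?rpredZ.
  by rewrite rpredZeq (negPf vT) orbF => /eqP k0; rewrite e k0 scale0r eqxx in y0.
have vH : v \notin H.
  have yvH : y - v \in H by apply: (subvP sH); rewrite memv_line.
  by apply: contra yH => vH; rewrite -(subrK v y) rpredD.
have eS z : z \in S -> z \notin H -> (H + <[z]>)%VS = S.
  move=> zS zH; apply/eqP; rewrite eqEdim subv_add sHS -memvE zS /=.
  by rewrite dim_add_line // dH.
have [g [kg gH gy]] := automorphism_fix_move yH vH.
have gS : (g @: S)%VS = S.
  by rewrite -{1}(eS y) // limgD (limg_id_on gH) limg_line gy eS.
by have := memv_img g yT; rewrite (h g kg gS) gy (negPf vT).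
Qed.

(** Take [T] inside a complement of [S] if it fits; otherwise let [T] contain the complement, so
    that [S + T] is everything and the dimension formula applies. *)
Lemma small_intersection S b t : (b <= \dim {:V})%N ->
  (\dim S + b < \dim {:V} + t)%N -> (0 < t)%N ->
  exists2 T, \dim T = b & (\dim (S :&: T) < t)%N.
Proof.
move=> bn abt t0; have dC := dimv_compl S.
have [le|gt] := leqP b (\dim S^C).
  have [||T [_ sT dT]] := @subspace_between 0%VS S^C%VS b; rewrite ?sub0v ?dimv0 //.
  exists T => //; suff -> : (S :&: T)%VS = 0%VS by rewrite dimv0.
  by apply/eqP; rewrite -subv0 -(capv_compl S) capvS.
have [||T [sT _ dT]] := @subspace_between S^C%VS fullv b; rewrite ?subvf //.
  by rewrite bn ltnW.
exists T => //; have := dimv_sum_cap S T.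
have -> : (S + T)%VS = fullv.
  by apply/eqP; rewrite eqEsubv subvf -(addv_complf S) addvS.
rewrite dT; lia.
Qed.

(** Keep a hyperplane of [S] containing [S :&: Z] and add a vector of [Z] outside [S]. *)
Lemma adjacent_step S Z : \dim S = \dim Z -> S != Z ->
  exists S1, [/\ \dim S1 = \dim S, (\dim (S :&: S1)).+1 = \dim S
               & (\dim (S :&: Z) < \dim (S1 :&: Z))%N].
Proof.
move=> dSZ ne; have lt := dim_cap_lt erefl (esym dSZ) ne.
have /subvPn[w wZ wS] : ~~ (Z <= S)%VS.
  by apply: (not_sub (esym dSZ) erefl); rewrite eq_sym.
have [||C [sIC sCS dC]] := @subspace_between (S :&: Z)%VS S (\dim S).-1.
- exact: capvSl.
- by lia.
have wC : w \notin C by apply: contra wS => /(subvP sCS).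
exists (C + <[w]>)%VS; rewrite cap_add_line // dim_add_line // dC; split; try lia.
have wI : w \notin (S :&: Z)%VS by rewrite memv_cap (negPf wS).
rewrite -(dim_add_line wI); apply: dimvS.
rewrite subv_cap !subv_add -!memvE wZ capvSr /= andbT.
rewrite (subv_trans sIC (addvSl _ _)) /=.
by rewrite memvE addvSr.
Qed.

(** [T'] is [H + <[w]>] for a hyperplane [H] of [T] and a vector [w] outside [T], both chosen so
    that neither inequality breaks. *)
Lemma second_separating_subspace S S' T t : \dim S = \dim S' -> S != S' ->
  (t < \dim S)%N -> T != fullv ->
  (t <= \dim (S :&: T))%N -> (\dim (S' :&: T) < t)%N ->
  exists T', [/\ \dim T' = \dim T, T' != T,
                 (t <= \dim (S :&: T'))%N & (\dim (S' :&: T') < t)%N].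
Proof.
move=> dS neS ta TV tS tS'.
have SS' := not_sub dS erefl neS.
have nTV : ~~ (fullv <= T)%VS by apply: contra TV => h; rewrite eqEsubv subvf.
have T0 : T != 0%VS by apply: contraTneq tS => ->; rewrite capv0 dimv0; lia.
(* Passing to [H] costs [S] at most one dimension: [w] in [S] restores it, and when [S] lies in [T]
   the bound [t < \dim S] absorbs it. *)
have rem H w : (H <= T)%VS -> (\dim H).+1 = \dim T -> w \notin T ->
    (w \in S) || (S <= T)%VS -> (\dim (S' :&: (H + <[w]>)) < t)%N ->
    exists T', [/\ \dim T' = \dim T, T' != T,
                 (t <= \dim (S :&: T'))%N & (\dim (S' :&: T') < t)%N].
  move=> sHT dH wT wS lt; have wH : w \notin H by apply: contra wT => /(subvP sHT).
  have wT' : w \in (H + <[w]>)%VS by rewrite memvE addvSr.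
  exists (H + <[w]>)%VS; split=> //; first by rewrite dim_add_line.
    by apply: contraNneq wT => <-.
  have hyp := dim_cap_hyper S sHT.
  rewrite capvC in tS; case/orP: wS => [wS|sST].
    have wHS : w \notin (H :&: S)%VS by rewrite memv_cap (negPf wH).
    have : (H :&: S + <[w]> <= S :&: (H + <[w]>))%VS.
      rewrite subv_cap !subv_add -!memvE wS wT' capvSr /= andbT.
      exact: subv_trans (capvSl _ _) (addvSl _ _).
    by move/dimvS; rewrite dim_add_line //; move: tS dH hyp; clear; lia.
  rewrite (capv_idPr sST) in hyp.
  have : (H :&: S <= S :&: (H + <[w]>))%VS.
    by rewrite capvC capvS ?addvSl.
  by move/dimvS; move: ta dH hyp; clear; lia.
have [w [wT wS]] : exists w, w \notin T /\ (w \in S) || (S <= T)%VS.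
  case: (boolP (S <= T)%VS) => [_|/subvPn[w wS wT]].
    by case/subvPn: nTV => w _ wT; exists w; rewrite orbT.
  by exists w; rewrite wS.
have [T'0|T'n0] := eqVneq (S' :&: T)%VS 0%VS; last first.
  (* [H] omits a vector [y] of [S' :&: T], so the intersection with [S'] drops before [w] can raise
     it by at most one. *)
  have := memv_pick (S' :&: T); set y := vpick _ => yI.
  have y0 : y != 0 by rewrite vpick0.
  move: (yI); rewrite memv_cap => /andP[yS' yT].
  have [|||H [_ sHT yH dH]] := @hyperplane_avoiding T 0%VS y; rewrite ?sub0v ?memv0 //.
  apply: (rem H w) => //; apply: leq_ltn_trans tS'.
  have hyp := dim_cap_hyper S' (addvSl H <[w]>).
  rewrite dim_add_line in hyp; last by apply: contra wT => /(subvP sHT).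
  have : (\dim (H :&: S') < \dim (S' :&: T))%N.
    rewrite ltnNge; apply/negP=> le; move: yH; apply/negP/negPn.
    have sI : (H :&: S' <= S' :&: T)%VS by rewrite capvC capvS.
    have e : (H :&: S')%VS = (S' :&: T)%VS by apply/eqP; rewrite eqEdim sI.
    by move: yI; rewrite -e memv_cap => /andP[].
  by move=> lt; rewrite capvC; move: hyp lt; clear; lia.
(* With [S' :&: T] zero, a vector outside [H + S'] keeps the new subspace's intersection with [S']
   zero. *)
have fin H v : (H <= T)%VS -> v \notin (H + S')%VS -> (\dim (S' :&: (H + <[v]>)) < t)%N.
  move=> sHT vHS; suff -> : (S' :&: (H + <[v]>))%VS = 0%VS by rewrite dimv0 (leq_ltn_trans _ tS').
  apply/eqP; rewrite -subv0 -T'0; apply/subvP=> z; rewrite !memv_cap.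
  case/andP=> zS' /memv_addP[h hH [u /vlineP[k ->] e]]; rewrite zS' /=.
  suff k0 : k = 0 by rewrite e k0 scale0r addr0 (subvP sHT).
  apply/eqP; have : k *: v \in (H + S')%VS.
    have -> : k *: v = - h + z by rewrite e addrA addNr add0r.
    by rewrite memv_add // rpredN.
  by rewrite rpredZeq (negPf vHS) orbF.
have := memv_pick T; set y := vpick T => yT.
have y0 : y != 0 by rewrite vpick0.
have [sST|nST] := boolP (S <= T)%VS.
  have [|||H [_ sHT yH dH]] := @hyperplane_avoiding T 0%VS y; rewrite ?sub0v ?memv0 //.
  have nHS : ~~ (fullv <= H + S')%VS.
    apply/negP=> /dimvS; have := dimvS (subvf (T + S')).
    have := dimv_sum_cap T S'; rewrite capvC T'0 dimv0.
    have := dimv_sum_cap H S'; have := dimvS sST; move: dH ta; clear; lia.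
  have [v [_ vT vHS]] := avoid_two nTV nHS.
  by apply: (rem H v) => //; [rewrite sST orbT|apply: fin].
have [v [vS vT vS']] := avoid_two nST SS'.
(* If [v = z + s] with [z] in [T] and [s] in [S'], the component [z] is unique, so a hyperplane of
   [T] omitting [z] keeps [v] out of [H + S']. *)
have [z [zT z0 hz]] : exists z, [/\ z \in T, z != 0
    & forall H, (H <= T)%VS -> z \notin H -> v \notin (H + S')%VS].
  have [/memv_addP[z zT [s sS' e]]|vTS] := boolP (v \in (T + S')%VS); last first.
    by exists y; split=> // H sHT _; apply: contra vTS; apply/subvP/addvS.
  exists z; split=> //; first by apply: contraNneq vS' => z0; rewrite e z0 add0r.
  move=> H sHT; apply: contra => /memv_addP[h hH [s' s'S' e']].
  have : z - h \in (S' :&: T)%VS.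
    rewrite memv_cap (rpredB zT) ?(subvP sHT) // andbT.
    have -> : z - h = s' - s.
      have -> : z = h + s' - s by rewrite -e' e addrK.
      by rewrite addrAC (addrC h) addrK.
    by rewrite rpredB.
  by rewrite T'0 memv0 subr_eq0 => /eqP->.
have [|||H [_ sHT zH dH]] := @hyperplane_avoiding T 0%VS z; rewrite ?sub0v ?memv0 //.
by apply: (rem H v) => //; [rewrite vS|apply: fin => //; apply: hz].
Qed.

(** Triangles of the Grassmann graph are of two kinds. If they share a hyperplane, join it with a
    new vector; otherwise they lie in a common space of one dimension more, and a suitable further
    subspace is taken inside it. *)
Lemma fourth_adjacent S S1 S2 : \dim S1 = \dim S -> \dim S2 = \dim S ->
  (1 < \dim S)%N -> (\dim S + 1 < \dim {:V})%N ->
  (\dim (S :&: S1)).+1 = \dim S -> (\dim (S :&: S2)).+1 = \dim S ->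
  (\dim (S1 :&: S2)).+1 = \dim S ->
  exists S3, [/\ \dim S3 = \dim S, (\dim (S :&: S3)).+1 = \dim S,
     (\dim (S1 :&: S3)).+1 = \dim S & (\dim (S2 :&: S3)).+1 = \dim S].
Proof.
move=> d1 d2 a2 an a01 a02 a12.
have [eC|neC] := eqVneq (S :&: S1)%VS (S :&: S2)%VS.
  have proper W : (\dim W < \dim {:V})%N -> ~~ (fullv <= W)%VS.
    by move=> lt; apply/negP=> /dimvS; lia.
  have [||w [_ wS wS2]] := @avoid_two fullv (S + S1)%VS S2.
  - by apply: proper; have := dimv_sum_cap S S1; lia.
  - by apply: proper; lia.
  have wS0 : w \notin S by apply: contra wS; apply/subvP/addvSl.
  have wS1 : w \notin S1 by apply: contra wS; apply/subvP/addvSr.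
  exists (S :&: S1 + <[w]>)%VS; rewrite !cap_add_line ?capvSl ?capvSr //; last first.
    by rewrite eC capvSr.
  by rewrite dim_add_line // memv_cap (negPf wS0).
have dlt : (\dim (S :&: S1 :&: (S :&: S2)) < (\dim S).-1)%N.
  by apply: dim_cap_lt => //; lia.
have [w wI wS] : exists2 w, w \in (S1 :&: S2)%VS & w \notin S.
  apply/subvPn/negP=> sIS.
  have : (S1 :&: S2 <= S :&: S1 :&: (S :&: S2))%VS.
    by rewrite !subv_cap sIS capvSl capvSr.
  by move/dimvS; lia.
move: wI; rewrite memv_cap => /andP[wS1 wS2].
have /subvPn[c1 c1C1 c1C2] : ~~ (S :&: S1 <= S :&: S2)%VS.
  by apply: (@not_sub _ _ (\dim S).-1) => //; lia.
have /subvPn[c2 c2C2 c2C1] : ~~ (S :&: S2 <= S :&: S1)%VS.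
  by apply: (@not_sub _ _ (\dim S).-1); rewrite 1?eq_sym //; lia.
move: c1C1 c2C2; rewrite !memv_cap => /andP[c1S c1S1] /andP[c2S c2S2].
have c1S2 : c1 \notin S2 by move: c1C2; rewrite memv_cap c1S.
have c2S1 : c2 \notin S1 by move: c2C1; rewrite memv_cap c2S.
have cS1 : c1 + c2 \notin S1 by rewrite rpredDl.
have cS2 : c1 + c2 \notin S2 by rewrite rpredDr.
pose D := (S :&: S1 :&: S2)%VS.
have dD : (\dim D).+2 = \dim S.
  have -> : \dim D = \dim (S :&: S1 :&: (S :&: S2)).
    congr (\dim _); apply/vspaceP=> z; rewrite !memv_cap.
    by case: (z \in S); rewrite ?andbF.
  have : (S :&: S1 + S :&: S2 <= S)%VS by rewrite subv_add !capvSl.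
  move/dimvS; have := dimv_sum_cap (S :&: S1) (S :&: S2).
  move: dlt a01 a02 a2; clear; lia.
have sD S' : (S :&: S1 <= S')%VS || (S1 :&: S2 <= S')%VS -> (D <= S')%VS.
  case/orP; apply: subv_trans; first exact: capvSl.
  by rewrite /D -capvA capvSr.
have DS : (D <= S)%VS by apply: sD; rewrite capvSl.
have DS1 : (D <= S1)%VS by apply: sD; rewrite capvSr.
have DS2 : (D <= S2)%VS by apply: sD; rewrite capvSr orbT.
have wD : w \notin D by rewrite !memv_cap (negPf wS).
have cD : c1 + c2 \notin D by rewrite !memv_cap (negPf cS1) andbF.
have sE S' : (D <= S')%VS -> w \in S' -> (D + <[w]> <= S')%VS.
  by move=> sDS' wS'; rewrite subv_add sDS' -memvE.
have dS3 : \dim (D + <[w]> + <[c1 + c2]>) = \dim S.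
  rewrite !dim_add_line // (contra _ cS1) //; exact/subvP/sE.
(* Each intersection is [D] plus one line: [c1 + c2] lies in [S] only, and [w] in [S1] and [S2]
   only. *)
exists (D + <[w]> + <[c1 + c2]>)%VS; split=> //.
- have cS : c1 + c2 \in S by rewrite rpredD.
  have sC : (D + <[c1 + c2]> <= S)%VS by rewrite subv_add DS -memvE.
  have -> : (D + <[w]> + <[c1 + c2]> = D + <[c1 + c2]> + <[w]>)%VS.
    by rewrite -!addvA (addvC <[w]>%VS).
  by rewrite cap_add_line // dim_add_line.
- by rewrite cap_add_line ?sE // dim_add_line.
- by rewrite cap_add_line ?sE // dim_add_line.
Qed.

End Subspaces.

(** * The Grassmannian as a bipartite relation *)

Section Grassmannian.
Variables (F : finFieldType) (V : vectType F).

Definition grassmannian (k : nat) : finType := {U : {vspace V} | \dim U == k}.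

Definition t_meet (t a b : nat) (x : grassmannian a) (y : grassmannian b) :
    bool :=
  (t <= \dim (val x :&: val y))%N.

Lemma dim_val k (x : grassmannian k) : \dim (val x) = k.
Proof. exact/eqP/(valP x). Qed.

Lemma grassmannian_of k (U : {vspace V}) : \dim U = k ->
  exists x : grassmannian k, val x = U.
Proof. by move/eqP=> dU; exists (Sub U dU); rewrite SubK. Qed.

Lemma dim_limg (g : 'End(V)) (U : {vspace V}) : lker g == 0%VS ->
  \dim (g @: U) = \dim U.
Proof. by move/eqP=> kg; rewrite limg_dim_eq // kg capv0. Qed.

Lemma limg_perm k (g : 'End(V)) : lker g == 0%VS ->
  exists s : {perm grassmannian k}, forall x, val (s x) = (g @: val x)%VS.
Proof.
move=> kg.
have P (x : grassmannian k) : \dim (g @: val x) == k by rewrite dim_limg // dim_val.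
pose f x : grassmannian k := Sub (g @: val x)%VS (P x).
have inj_f : injective f.
  move=> x y /(congr1 val); rewrite !SubK => /eqP; rewrite eq_limg_ker0 //.
  by move/eqP/val_inj.
by exists (perm inj_f) => x; rewrite permE SubK.
Qed.

(** Stated for any [R] agreeing with [t_meet], so that it also covers the reversed relation, where
    the intersection is written the other way round. *)
Lemma limg_aut a b t (R : grassmannian a -> grassmannian b -> bool) (g : 'End(V)) :
  (forall x y, R x y = t_meet t x y) -> lker g == 0%VS ->
  exists s s', [/\ graph_aut R s s', forall x, val (s x) = (g @: val x)%VS
                 & forall y, val (s' y) = (g @: val y)%VS].
Proof.
move=> RE kg; have [s hs] := limg_perm a kg; have [s' hs'] := limg_perm b kg.
exists s, s'; split=> //; apply/graph_autP=> x y.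
by rewrite !RE /t_meet hs hs' -lker0_img_cap // dim_limg.
Qed.

Definition adjacent k (x y : grassmannian k) : bool :=
  (\dim (val x :&: val y)).+1 == k.

Lemma adjacentC k (x y : grassmannian k) : adjacent x y = adjacent y x.
Proof. by rewrite /adjacent capvC. Qed.

Lemma adjacent_neq k (x y : grassmannian k) : adjacent x y -> x != y.
Proof.
by apply: contraTneq => ->; rewrite /adjacent capvv dim_val eqn_leq ltnn.
Qed.

(** Connectivity of the Grassmann graph: each [adjacent_step] enlarges the intersection with the
    target [z]. *)
Lemma adjacent_closed_full k (U : {set grassmannian k}) : U != set0 ->
  (forall x y, x \in U -> adjacent x y -> y \in U) -> U = setT.
Proof.
case/set0Pn=> x0 x0U cl; apply/setP=> z; rewrite inE.
have [j] := ubnP (k - \dim (val x0 :&: val z)); elim: j x0 x0U => // j IH x xU.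
rewrite ltnS => le; have [<-//|ne] := eqVneq x z.
have [||S1 [d1 a1 lt]] := @adjacent_step _ _ (val x) (val z).
- by rewrite !dim_val.
- by apply: contra ne => /eqP/val_inj->.
rewrite dim_val in d1; have [x1 e1] := grassmannian_of d1.
have x1U : x1 \in U by apply: cl xU _; rewrite /adjacent e1 a1 dim_val.
apply: (IH x1 x1U); rewrite e1; have := dimvS (capvSr S1 (val z)).
rewrite dim_val; move: lt le; clear; lia.
Qed.

(** * The linear automorphisms acting on the relation *)

Section Action.
Variables (t a b : nat) (R : grassmannian a -> grassmannian b -> bool).
Hypothesis RE : forall x y, R x y = t_meet t x y.
Hypothesis t0 : (0 < t)%N.
Hypothesis ta : (t < a)%N.
Hypothesis tb : (t < b)%N.
Hypothesis abnt : (a + b < \dim {:V} + t)%N.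

Lemma grassmannian_transitive : transitive_aut R.
Proof.
move=> x x'.
have [|g kg hg] := @free_automorphism _ _ (vbasis (val x)) (vbasis (val x'))
   (basis_free (vbasisP _)) (basis_free (vbasisP _)).
  by rewrite !size_tuple !dim_val.
have [s [s' [h hs _]]] := limg_aut RE kg; exists s, s'; split=> //.
apply: val_inj; rewrite hs -(span_basis (vbasisP (val x))) limg_span hg.
by rewrite (span_basis (vbasisP _)).
Qed.

Lemma proper_dim (U : {vspace V}) : (\dim U < \dim {:V})%N -> ~~ (fullv <= U)%VS.
Proof. by move=> lt; apply/negP=> /dimvS; rewrite leqNgt lt. Qed.

Lemma proper_neq (U : {vspace V}) : (\dim U < \dim {:V})%N -> U != fullv.
Proof. by apply: contraTneq => ->; rewrite ltnn. Qed.

Lemma adjacent_aut x x1 x2 : adjacent x x1 -> adjacent x x2 ->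
  exists s s', [/\ graph_aut R s s', s x = x & s x1 = x2].
Proof.
move=> /eqP a1 /eqP a2.
have [||||g [kg gx g1]] := @adjacent_automorphism _ _ (val x) (val x1) (val x2);
  rewrite ?dim_val //.
have [s [s' [h hs _]]] := limg_aut RE kg; exists s, s'; split=> //.
  by apply: val_inj; rewrite hs gx.
by apply: val_inj; rewrite hs g1.
Qed.

(** A block with two members contains, next to each member, an adjacent one; transitivity on
    adjacent pairs then puts every neighbour in the block, and connectivity everything. *)
Lemma grassmannian_primitive : primitive_aut R.
Proof.
move=> U U0 UT blk.
apply/eqP; rewrite eqn_leq card_gt0 U0 andbT leqNgt; apply/negP=> U2.
have stable s s' y z : graph_aut R s s' -> y \in U -> s y \in U -> z \in U -> s z \in U.
  move=> h yU syU zU; rewrite -(blk s s' h) ?imset_f //.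
  by apply/set0Pn; exists (s y); rewrite inE imset_f.
have near y : y \in U -> exists2 z, z \in U & adjacent y z.
  move=> yU; have [x xU ne] : exists2 x, x \in U & x != y.
    have : (0 < #|U :\ y|)%N.
      by move: U2; rewrite (cardsD1 y U) yU add1n ltnS.
    by rewrite card_gt0 => /set0Pn[x]; rewrite !inE => /andP[? ?]; exists x.
  have nS : ~~ (val y <= val x)%VS.
    by apply: (not_sub (dim_val _) (dim_val _)); apply: contra ne => /eqP/val_inj->.
  case/subvPn: nS => v vy vx.
  have vI : v \notin (val y :&: val x)%VS by rewrite memv_cap (negPf vx) andbF.
  (* As [y] is [C + <[v]>], an automorphism fixing [x] and [C] pointwise and sending [v] outside [y]
     moves [y] to an adjacent subspace; [x] stays put, so the image stays in the block. *)
  have [C [sIC sCy vC dC]] := hyperplane_avoiding (capvSl _ _) vy vI.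
  have vxC : v \notin (val x + C)%VS.
    apply: contra vC => /memv_addP[z zx [c cC e]].
    rewrite e rpredD //; apply: (subvP sIC); rewrite memv_cap zx andbT.
    have -> : z = v - c by rewrite e addrK.
    by rewrite rpredB // (subvP sCy).
  have [||w [_ wy wxC]] := @avoid_two _ _ fullv (val y) (val x + C)%VS.
  - by apply: proper_dim; rewrite dim_val; move: abnt tb; clear; lia.
  - by apply/negP=> /subvP/(_ v (memvf v)); rewrite (negPf vxC).
  have [g [kg gxC gv]] := automorphism_fix_move vxC wxC.
  have [s [s' [h hs _]]] := limg_aut RE kg.
  have gC : (g @: C)%VS = C.
    by apply: limg_id_on => c cC; apply: gxC; apply: (subvP (addvSr _ _)).
  have sx : s x = x.
    apply: val_inj; rewrite hs; apply: limg_id_on => c cx; apply: gxC.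
    exact: (subvP (addvSl _ _)).
  exists (s y); first by apply: (stable s s' x) => //; rewrite sx.
  have ey : val y = (C + <[v]>)%VS.
    apply/eqP; rewrite eq_sym eqEdim subv_add sCy -memvE vy /=.
    by rewrite dim_add_line // dC.
  rewrite /adjacent hs {2}ey limgD gC limg_line gv cap_add_line // dC dim_val.
  by [].
move: UT; rewrite (adjacent_closed_full U0) ?eqxx // => x y xU axy.
have [z zU axz] := near x xU.
have [s [s' [h sx sz]]] := adjacent_aut axz axy.
by rewrite -sz; apply: (stable s s' x) => //; rewrite sx.
Qed.

Lemma t_meet_fails x : exists y, ~~ R x y.
Proof.
have [|||T dT lt] := @small_intersection _ _ (val x) b t; rewrite ?dim_val //.
  by move: abnt ta; clear; lia.
have [y ey] := grassmannian_of dT; exists y.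
by rewrite RE /t_meet ey -ltnNge.
Qed.

Lemma t_meet_second_separator x x' y : R x y -> ~~ R x' y ->
  exists2 y', y' != y & R x y' && ~~ R x' y'.
Proof.
move=> Rxy nR; have ne : x != x' by apply: contraNneq nR => <-.
rewrite !RE /t_meet -?ltnNge in Rxy nR.
have [||||||T' [dT' neT Rx Rx']] := @second_separating_subspace _ _ (val x) (val x') (val y) t.
- by rewrite !dim_val.
- by apply: contra ne => /eqP/val_inj->.
- by rewrite dim_val.
- by apply: proper_neq; rewrite dim_val; move: abnt ta; clear; lia.
- by [].
- by [].
rewrite dim_val in dT'; have [y' ey] := grassmannian_of dT'; exists y'.
  by apply: contra neT => /eqP <-; rewrite ey.
by rewrite !RE /t_meet ey Rx -ltnNge Rx'.
Qed.

(** In particular the two types of subspaces then have the same dimension. *)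
Lemma stabilizer_fixed x y : (forall s s', graph_aut R s s' -> s x = x -> s' y = y) ->
  val y = val x.
Proof.
move=> h; apply: fixed_by_stabilizer.
- by rewrite -dimv_eq0 dim_val; move: tb; clear; lia.
- by apply: proper_neq; rewrite dim_val; move: abnt ta; clear; lia.
- by apply: proper_neq; rewrite dim_val; move: abnt tb; clear; lia.
move=> g kg gx; have [s [s' [ss hs hs']]] := limg_aut RE kg.
by rewrite -hs' (h s s' ss) //; apply: val_inj; rewrite hs.
Qed.

(** The vertex attached to [x] is [x] itself, so adjacent points are collinear. Adjacent triangles,
    then all neighbours of a point, then by connectivity all points, lie on one line. *)
Lemma no_two_line_structure L : ~ two_line_structure R L.
Proof.
case=> TL meetL pts.
have coll x : exists l1 l2, [/\ l1 \in L, l2 \in L, x \in l1 :&: l2,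
    forall l, l \in L -> x \in l -> l = l1 \/ l = l2
    & forall x', (x' \in l1 :|: l2) = (t <= \dim (val x :&: val x'))%N].
  have [l1 [l2 [y [[l1L l2L xl1 xl2] eU only fixy]]]] := pts x.
  exists l1, l2; split=> //; first by rewrite inE xl1.
  by move=> x'; rewrite eU inE RE /t_meet (stabilizer_fixed fixy) capvC.
have lines_eq l l' x x' : l \in L -> l' \in L -> x != x' ->
    x \in l -> x' \in l -> x \in l' -> x' \in l' -> l = l'.
  move=> lL lL' ne xl x'l xl' x'l'; apply/eqP; apply: contraT => ne'.
  have := meetL _ _ lL lL' ne'; rewrite leqNgt => /negP[].
  apply: (@leq_trans #|[set x; x']|); first by rewrite cards2 ne.
  by apply/subset_leq_card/subsetP=> z; rewrite !inE => /orP[]/eqP->; apply/andP.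
have adj_coll (x x' : grassmannian a) : adjacent x x' -> (t <= \dim (val x :&: val x'))%N.
  by rewrite /adjacent => /eqP e; rewrite -ltnS e.
have line2 x x' : adjacent x x' -> exists l, [/\ l \in L, x \in l & x' \in l].
  move=> axx; have [l1 [l2 [l1L l2L xI _ cx]]] := coll x.
  move: xI (adj_coll _ _ axx); rewrite inE -cx inE => /andP[xl1 xl2] /orP[h|h].
    by exists l1.
  by exists l2.
(* Through each point pass only two lines, so a triangle of three distinct
   lines admits no further point adjacent to its three vertices. *)
have clique x x1 x2 x3 : adjacent x x1 -> adjacent x x2 -> adjacent x1 x2 ->
    adjacent x x3 -> adjacent x1 x3 -> adjacent x2 x3 ->
    exists l, [/\ l \in L, x \in l, x1 \in l & x2 \in l].
  move=> a1 a2 a12 a3 a13 a23.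
  have [p [pL xp p1]] := line2 _ _ a1; have [q [qL xq q2]] := line2 _ _ a2.
  have [r [rL r1 r2]] := line2 _ _ a12.
  have [u [uL xu u3]] := line2 _ _ a3; have [v [vL v1 v3]] := line2 _ _ a13.
  have [w [wL w2 w3]] := line2 _ _ a23.
  have two y k1 k2 k3 : k1 \in L -> k2 \in L -> k3 \in L ->
      y \in k1 -> y \in k2 -> y \in k3 -> [\/ k1 = k2, k1 = k3 | k2 = k3].
    have [m1 [m2 [_ _ _ only _]]] := coll y.
    move=> L1 L2 L3 y1 y2 y3.
    case: (only _ L1 y1) => ->; case: (only _ L2 y2) => ->;
    case: (only _ L3 y3) => ->; by [apply: Or31|apply: Or32|apply: Or33].
  have n1 := adjacent_neq a1; have n2 := adjacent_neq a2; have n12 := adjacent_neq a12.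
  have n3 := adjacent_neq a3; have n13 := adjacent_neq a13; have n23 := adjacent_neq a23.
  have [e|e|e] := two _ _ _ _ pL qL uL xp xq xu.
  - by exists p; split=> //; rewrite e.
  - subst u; have [e|e|e] := two _ _ _ _ qL rL wL q2 r2 w2.
    + by exists q; split=> //; rewrite e.
    + by subst w; have e := lines_eq _ _ _ _ pL qL n3 xp u3 xq w3; exists q; split=> //; rewrite -e.
    + by subst w; have e := lines_eq _ _ _ _ pL rL n13 p1 u3 r1 w3; exists p; split=> //; rewrite e.
  - subst u; have [e|e|e] := two _ _ _ _ pL rL vL p1 r1 v1.
    + by exists p; split=> //; rewrite e.
    + by subst v; have e := lines_eq _ _ _ _ pL qL n3 xp v3 xq u3; exists p; split=> //; rewrite e.
    + by subst v; have e := lines_eq _ _ _ _ qL rL n23 q2 u3 r2 v3; exists q; split=> //; rewrite e.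
(* [fourth_adjacent] supplies the fourth point that [clique] asks for. *)
have triangle x x1 x2 l : l \in L -> x \in l -> x1 \in l ->
    adjacent x x1 -> adjacent x x2 -> adjacent x1 x2 -> x2 \in l.
  move=> lL xl x1l a1 a2 a12.
  have [/eqP b1 /eqP b2 /eqP b12] := And3 a1 a2 a12.
  have [|||||||S3 [d3 a3 a13 a23]] :=
    @fourth_adjacent _ _ (val x) (val x1) (val x2); rewrite ?dim_val //.
  - by move: t0 ta; clear; lia.
  - by move: abnt tb; clear; lia.
  rewrite dim_val in d3 a3 a13 a23; have [x3 e3] := grassmannian_of d3.
  have [|||l' [l'L xl' x1l' x2l']] := clique x x1 x2 x3 a1 a2 a12;
    rewrite /adjacent ?e3 ?a3 ?a13 ?a23 //.
  by rewrite (lines_eq _ _ _ _ lL l'L (adjacent_neq a1) xl x1l xl' x1l').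
(* The intermediate [x12], spanned by [val x :&: val x2] and a vector of [x1] outside [x], is
   adjacent to [x] and equal or adjacent to both [x1] and [x2]; two triangles carry [l] from [x1] to
   [x2]. *)
have spread x x1 x2 l : l \in L -> x \in l -> x1 \in l ->
    adjacent x x1 -> adjacent x x2 -> x2 \in l.
  move=> lL xl x1l a1 a2.
  have tri y y' : y \in l -> adjacent x y -> adjacent x y' ->
      (a <= (\dim (val y :&: val y')).+1)%N -> y' \in l.
    move=> yl ay ay' le; have [<-//|ne] := eqVneq y y'.
    apply: (triangle x y y' l) => //; rewrite /adjacent eqn_leq le andbT.
    apply: dim_cap_lt; rewrite ?dim_val //.
  have dx := dim_val x; have d1 := dim_val x1.
  have dxx : \dim (val x1) = \dim (val x) by rewrite dx d1.
  have [|w [wx1 wx ex1]] := @adjacent_decomp _ _ (val x1) (val x) dxx.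
    by rewrite capvC d1; apply/eqP.
  pose C2 := (val x :&: val x2)%VS.
  have dC2 : (\dim C2).+1 = a by apply/eqP.
  have wC2 : w \notin C2 by rewrite memv_cap (negPf wx).
  have d12 : \dim (C2 + <[w]>) = a by rewrite dim_add_line.
  have [x12 e12] := grassmannian_of d12.
  have a12 : adjacent x x12.
    by rewrite /adjacent e12 cap_add_line ?capvSl // dC2.
  have x12l : x12 \in l.
    apply: (tri x1 x12) => //.
    have wI : w \notin (val x :&: val x1 :&: C2)%VS by rewrite !memv_cap (negPf wx).
    have : (val x :&: val x1 :&: C2 + <[w]> <= val x1 :&: val x12)%VS.
      rewrite e12 subv_cap !subv_add -!memvE wx1 andbT.
      rewrite (subv_trans (capvSl _ _) (capvSr _ _)) /=.
      rewrite (subv_trans (capvSr _ _) (addvSl _ _)) /=.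
      by rewrite memvE addvSr.
    move/dimvS; rewrite dim_add_line //.
    have : (val x :&: val x1 + C2 <= val x)%VS by rewrite subv_add !capvSl.
    move/dimvS; have := dimv_sum_cap (val x :&: val x1) C2.
    move/eqP: a1; move: dC2 dx; clear; lia.
  apply: (tri x12 x2) => //.
  have : (C2 <= val x12 :&: val x2)%VS by rewrite e12 subv_cap addvSl capvSr.
  by move/dimvS; move: dC2; clear; lia.
have [x0 _] : exists x : grassmannian a, true.
  have [||U [_ _ dU]] := @subspace_between F V 0%VS fullv a; rewrite ?subvf //.
    by rewrite dimv0; move: abnt tb; clear; lia.
  by have [x _] := grassmannian_of dU; exists x.
have [x1 a01] : exists x1, adjacent x0 x1.
  have [||C [_ sC dC]] := @subspace_between _ _ 0%VS (val x0) a.-1.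
  - by rewrite sub0v.
  - by rewrite dimv0 dim_val leq_pred.
  have /subvPn[w _ wx] : ~~ (fullv <= val x0)%VS.
    by apply: proper_dim; rewrite dim_val; move: abnt tb; clear; lia.
  have wC : w \notin C by apply: contra wx => /(subvP sC).
  have dC' : (\dim C).+1 = a by rewrite dC; move: ta; clear; lia.
  have [|x1 e1] := @grassmannian_of a (C + <[w]>)%VS; first by rewrite dim_add_line.
  by exists x1; rewrite /adjacent e1 cap_add_line // dC'.
have [l [lL x0l x1l]] := line2 _ _ a01.
(* By [spread], one neighbour on [l] brings all neighbours onto [l], so [U] is closed under
   adjacency. *)
pose U := [set z in l | [exists z1 in l, adjacent z z1]].
have U0 : U != set0.
  apply/set0Pn; exists x0; rewrite inE x0l; apply/exists_inP.
  by exists x1.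
suff /(adjacent_closed_full U0) eU : forall x y, x \in U -> adjacent x y -> y \in U.
  move: TL; suff <- : l = setT by rewrite lL.
  by apply/eqP; rewrite -subTset -eU; apply/subsetP=> z; rewrite inE => /andP[].
move=> x y; rewrite !inE => /andP[xl /exists_inP[z zl axz]] axy.
rewrite (spread x z y l) //=; apply/exists_inP; exists x => //.
by rewrite adjacentC.
Qed.

End Action.
End Grassmannian.

(** * Gaussian binomial counts *)

Lemma card_vspace_elements (F : finFieldType) (V : vectType F) (U : {vspace V}) :
  #|[set x : finvect_type V | (x : V) \in U]| = (#|F| ^ \dim U)%N.
Proof.
case: V U => T c U; rewrite cardsE.
pose fT : finType := finvect_type (Vector.Pack c).
by rewrite -(@card_vspace F fT c U); apply: eq_card.
Qed.

Section Counting.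
Variables (F : finFieldType) (V : vectType F).
Local Notation q := #|F|.
Local Notation fV := (finvect_type V).
Implicit Types (A I T W : {vspace V}).

Lemma card_vspaceD T A :
  #|[set x : fV | ((x : V) \in T) && ((x : V) \notin A)]|
    = (q ^ \dim T - q ^ \dim (T :&: A))%N.
Proof.
rewrite -!card_vspace_elements.
have -> : [set x : fV | ((x : V) \in T) && ((x : V) \notin A)]
        = [set x : fV | (x : V) \in T] :\: [set x : fV | (x : V) \in (T :&: A)%VS].
  by apply/setP=> x; rewrite !inE memv_cap; case: (_ \in T); rewrite ?andbF ?andbT.
rewrite cardsD; congr (_ - _)%N; apply: eq_card => x.
by rewrite !inE memv_cap; case: (_ \in T).
Qed.

Definition meeting W A I k : {set {vspace V}} :=
  [set T | [&& (T <= W)%VS, (T :&: A)%VS == I & \dim T == k]].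

(* A subspace through [x \notin A] meets [A] in [I] iff it meets [A + <[x]>] in
   [I + <[x]>]; counting incident pairs (x, T) then gives the induction step. *)
Lemma card_meeting c : forall W A I, (A <= W)%VS -> (I <= A)%VS ->
  (#|meeting W A I (\dim I + c)| * \prod_(k < c) (q ^ (\dim I + c) - q ^ (\dim I + k))
   = \prod_(k < c) (q ^ \dim W - q ^ (\dim A + k)))%N.
Proof.
elim: c => [|c IH] W A I sAW sIA.
  rewrite !big_ord0 muln1 addn0; apply/eqP/cards1P; exists I; apply/setP=> T.
  rewrite !inE; apply/and3P/eqP=> [[_ /eqP e /eqP d]|->].
    by apply/eqP; rewrite eq_sym eqEdim d leqnn andbT -e capvSl.
  by rewrite (subv_trans sIA sAW) (capv_idPl sIA) !eqxx.
have step x : x \in W -> x \notin A ->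
    (#|[set T in meeting W A I (\dim I + c.+1) | x \in T]|
      * \prod_(k < c) (q ^ (\dim I + c.+1) - q ^ (\dim I + k.+1))
      = \prod_(k < c) (q ^ \dim W - q ^ (\dim A + k.+1)))%N.
  move=> xW xA; have xI : x \notin I by apply: contra xA => /(subvP sIA).
  have := IH W (A + <[x]>)%VS (I + <[x]>)%VS.
  rewrite subv_add sAW -memvE xW (addvS sIA (subvv _)) => /(_ isT isT).
  rewrite !dim_add_line // addSnnS.
  under eq_bigr do rewrite addSnnS.
  under [in RHS]eq_bigr do rewrite addSnnS.
  move=> <-; congr (_ * _)%N; apply: eq_card => T; rewrite !inE.
  apply/andP/and3P=> [[/and3P[TW /eqP e dT] xT]|[TW /eqP e dT]].
    split=> //; apply/eqP/vspaceP=> z; rewrite memv_cap.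
    apply/andP/memv_addP=> [[zT /memv_addP[a aA [u uL ez]]]|[i iI [u uL ->]]].
      exists a; last by exists u.
      rewrite -e memv_cap aA andbT; have -> : a = z - u by rewrite ez addrK.
      by case/vlineP: uL => k ->; rewrite rpredB // rpredZ.
    split; last by rewrite memv_add // (subvP sIA).
    case/vlineP: uL => k ->; rewrite rpredD ?rpredZ //.
    by apply: (subvP (capvSl T A)); rewrite e.
  have xT : x \in T.
    by apply: (subvP (capvSl T (A + <[x]>))); rewrite e; apply: (subvP (addvSr _ _)); apply: memv_line.
  rewrite TW dT xT; split=> //; apply/and3P; split=> //.
  rewrite -(cap_add_line sIA xA) -e capvC capvA [(A :&: T)%VS]capvC -capvA.
  by rewrite (capv_idPl (addvSl A <[x]>)).
pose S := meeting W A I (\dim I + c.+1)%N.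
(* Every [T] in [S] meets [A] exactly in [I], so it has the same number of vectors outside [A]. *)
have count : (#|S| * (q ^ (\dim I + c.+1) - q ^ \dim I)
    = \sum_(x in [set x : fV | ((x : V) \in W) && ((x : V) \notin A)])
        #|[set T in S | (x : V) \in T]|)%N.
  transitivity (\sum_(T in S) \sum_(x in [set x : fV | ((x : V) \in W) && ((x : V) \notin A)])
      ((x : V) \in T : nat))%N.
    rewrite -sum_nat_const; apply: eq_bigr => T.
    rewrite inE => /and3P[TW /eqP e /eqP dT].
    rewrite -dT -e -card_vspaceD -big_mkcondr sum1_card; apply: eq_card => x.
    rewrite [in RHS]unfold_in /= !inE.
    case: (boolP (_ \in T)) => xT; last by rewrite andbF.
    by rewrite andbT (subvP TW).
  rewrite exchange_big; apply: eq_bigr => x _.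
  by rewrite -big_mkcondr sum1_card; apply: eq_card => T; rewrite [RHS]inE.
rewrite !big_ord_recl !addn0 mulnA count big_distrl /=.
rewrite (eq_bigr (fun=> \prod_(k < c) (q ^ \dim W - q ^ (\dim A + k.+1))))%N.
  by rewrite sum_nat_const card_vspaceD (capv_idPr sAW).
by move=> x; rewrite inE => /andP[xW xA]; apply: step.
Qed.

Lemma card_field_gt1 : (1 < q)%N.
Proof. by have := finNzRing_gt1 F. Qed.

Lemma expB1_neq0 k : (0 < k)%N -> (q%:R ^+ k - 1 : rat) != 0.
Proof.
move=> k0; rewrite subr_eq0 -natrX pnatr_eq1 -(expn0 q) eqn_exp2l ?card_field_gt1 //.
by rewrite -lt0n.
Qed.

(** Also valid for [m < j]: both sides vanish under truncated subtraction. *)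
Lemma natr_expB m j : ((q ^ m - q ^ j)%N%:R : rat) = q%:R ^+ j * (q%:R ^+ (m - j) - 1).
Proof.
have q0 := ltnW card_field_gt1.
case: (leqP j m) => le.
  rewrite natrB ?leq_pexp2l // !natrX mulrBr mulr1 -exprD subnKC //.
rewrite (eqP (ltnW le : (m - j == 0)%N)) expr0 subrr mulr0.
by apply/eqP; rewrite pnatr_eq0 subn_eq0 leq_pexp2l // ltnW.
Qed.

(** Dividing the two products of [card_meeting] factor by factor, each quotient contributes
    [q ^ (\dim A - \dim I)] and one factor of the Gaussian binomial. *)
Lemma card_meeting_gauss W A I k : (A <= W)%VS -> (I <= A)%VS -> (\dim I <= k)%N ->
  (#|meeting W A I k|%:R : rat)
  = q%:R ^+ ((\dim A - \dim I) * (k - \dim I))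
    * gauss_binom q (\dim W - \dim A) (k - \dim I).
Proof.
move=> sAW sIA Ik; set c := (k - \dim I)%N; have ek : (\dim I + c)%N = k by rewrite subnKC.
have := congr1 (fun m => m%:R : rat) (card_meeting c sAW sIA).
rewrite ek natrM !natr_prod.
have q0 : q%:R != 0 :> rat by rewrite pnatr_eq0 -lt0n ltnW ?card_field_gt1.
have nz : \prod_(j < c) ((q ^ k - q ^ (\dim I + j))%N%:R : rat) != 0.
  apply/prodf_neq0=> j _; rewrite natr_expB mulf_neq0 ?expf_neq0 //.
  by rewrite expB1_neq0 // -ek ltn_subRL addn0 ltn_add2l.
move/(canRL (mulfK nz)) => ->; rewrite -prodf_div exprM /gauss_binom.
have -> z : z ^+ c = \prod_(j < c) z :> rat by rewrite prodr_const card_ord.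
rewrite -big_split /=; apply: eq_bigr => j _.
rewrite !natr_expB -subnDA -ek subnDl.
have nzj := expB1_neq0 (_ : 0 < c - j)%N.
have {}nzj : (q%:R ^+ (c - j) - 1 : rat) != 0 by apply: nzj; rewrite subn_gt0.
have -> : q%:R ^+ (\dim A + j) = q%:R ^+ (\dim A - \dim I) * q%:R ^+ (\dim I + j) :> rat.
  by rewrite -exprD addnA subnK // dimvS.
field; rewrite nzj expf_neq0 //.
Qed.

Lemma card_subspaces k : (#|subspaces V k|%:R : rat) = gauss_binom q (\dim {:V}) k.
Proof.
have := @card_meeting_gauss fullv 0%VS 0%VS k (subvf _) (subvv _).
rewrite dimv0 !subn0 mul0n expr0 mul1r => <- //; congr (_%:R).
by apply: eq_card => T; rewrite !inE subvf capv0 eqxx.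
Qed.

Lemma card_subspaces_in A i :
  (#|[set I : {vspace V} | (I <= A)%VS && (\dim I == i)]|%:R : rat)
  = gauss_binom q (\dim A) i.
Proof.
have := @card_meeting_gauss A 0%VS 0%VS i (sub0v _) (subvv _).
rewrite dimv0 !subn0 mul0n expr0 mul1r => <- //; congr (_%:R).
by apply: eq_card => T; rewrite !inE capv0 eqxx.
Qed.

(** Sort the subspaces [T] by their trace [I] on [A], then the traces by dimension. *)
Lemma card_nbhd t b A : (t <= b)%N ->
  (#|nbhd t b A|%:R : rat)
  = \sum_(0 <= i < t) q%:R ^+ ((\dim A - i) * (b - i))
      * gauss_binom q (\dim A) i * gauss_binom q (\dim {:V} - \dim A) (b - i).
Proof.
move=> tb.
pose g i : rat := q%:R ^+ ((\dim A - i) * (b - i))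
      * gauss_binom q (\dim {:V} - \dim A) (b - i).
have -> : #|nbhd t b A| = (\sum_(I : {vspace V} | (I <= A)%VS && (\dim I < t)%N)
    #|meeting fullv A I b|)%N.
  transitivity (\sum_(I : {vspace V} | (I <= A)%VS && (\dim I < t)%N)
      \sum_(T in nbhd t b A) ((T :&: A)%VS == I : nat))%N.
    rewrite exchange_big /= -sum1_card; apply: eq_bigr => T.
    rewrite inE => /andP[_ lt].
    rewrite (bigD1 (T :&: A)%VS) /= ?capvSr // eqxx big1 ?addn0 // => I.
    by case/andP=> _ ne; rewrite eq_sym (negPf ne).
  apply: eq_bigr => I /andP[_ It].
  rewrite -big_mkcondr sum1_card; apply: eq_card => T.
  rewrite [in LHS]unfold_in /= !inE subvf /=.
  by case: (eqVneq (T :&: A)%VS I) => [->|_]; rewrite ?andbF // It !andbT.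
rewrite natr_sum.
(* The one-term inner sum over [i == \dim I] allows exchanging the sums, since the count depends on
   [I] only through its dimension. *)
transitivity (\sum_(I : {vspace V} | (I <= A)%VS && (\dim I < t)%N)
    \sum_(0 <= i < t | i == \dim I) g i).
  apply: eq_bigr => I /andP[sIA It]; rewrite big_nat1_eq It.
  by rewrite card_meeting_gauss ?subvf // ltnW // (leq_trans It).
rewrite (exchange_big_dep predT) //=.
rewrite big_nat [RHS]big_nat; apply: eq_bigr => i /= it.
rewrite -card_subspaces_in mulrAC -/(g i) mulrC.
rewrite mulr_natl -sumr_const; apply: eq_bigl => I.
rewrite inE eq_sym; case: eqP => [->|]; rewrite ?andbF //.
by rewrite it !andbT.
Qed.

End Counting.

(** * Transfer to families of subspaces *)

Local Open Scope nat_scope.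

Section Transfer.
Variables (F : finFieldType) (V : vectType F).

Lemma val_pullback k (cA : {set {vspace V}}) : cA \subset subspaces V k ->
  [set val x | x in [set x : grassmannian V k | val x \in cA]] = cA.
Proof.
move=> sub; apply/setP=> U; apply/imsetP/idP=> [[x]|UcA].
  by rewrite inE => h ->.
have := subsetP sub _ UcA; rewrite inE => /eqP/grassmannian_of[x ex].
by exists x; rewrite ?inE ex.
Qed.

Lemma card_pullback k (cA : {set {vspace V}}) : cA \subset subspaces V k ->
  #|[set x : grassmannian V k | val x \in cA]| = #|cA|.
Proof. by move=> sub; rewrite -{2}(val_pullback sub) card_imset //; apply: val_inj. Qed.

Lemma card_grassmannian k : #|grassmannian V k| = #|subspaces V k|.
Proof.
rewrite -(card_pullback (subxx _)) -cardsT; apply: eq_card => x.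
by rewrite !inE dim_val eqxx.
Qed.

Lemma val_nbrs t a b (x : grassmannian V a) :
  [set val y | y in [set y : grassmannian V b | t <= \dim (val x :&: val y)]]
  = subspaces V b :\: nbhd t b (val x).
Proof.
rewrite -[RHS](@val_pullback b) ?subsetDl //; congr [set val y | y in pred_of_set _].
by apply/setP=> y; rewrite !inE dim_val eqxx andbT /= -leqNgt capvC.
Qed.

Lemma card_nonnbhd t a b (x : grassmannian V a) : t <= b ->
  (#|subspaces V b :\: nbhd t b (val x)|%:R
   = gauss_binom #|F| (\dim {:V}) b
     - \sum_(0 <= i < t) #|F|%:R ^+ ((a - i) * (b - i))
        * gauss_binom #|F| a i * gauss_binom #|F| (\dim {:V} - a) (b - i) :> rat)%R.
Proof.
move=> tb; have := card_nbhd (val x) tb; rewrite dim_val => <-.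
rewrite -card_subspaces; apply/eqP; rewrite eq_sym subr_eq -natrD eqr_nat.
rewrite -(cardsID (nbhd t b (val x)) (subspaces V b)) addnC.
by rewrite (setIidPr _) //; apply/subsetP=> U; rewrite !inE => /andP[].
Qed.

(** The reversed relation is again [t_meet], with [a] and [b] exchanged, so each property is
    obtained for both sides from one lemma. *)
Lemma t_meet_fragment t a b (alpha : nat) (P : {set grassmannian V a}) :
  0 < t -> t < a -> t < b -> a + b < \dim {:V} + t ->
  (forall P : {set grassmannian V a}, P != set0 ->
     common_nbrs (@t_meet F V t a b) P != set0 ->
     #|P| + #|common_nbrs (@t_meet F V t a b) P| <= alpha) ->
  fragment (@t_meet F V t a b) alpha P ->
  #|P| = 1 \/ #|common_nbrs (@t_meet F V t a b) P| = 1.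
Proof.
move=> t0 ta tb abn amax.
pose R := @t_meet F V t a b; pose R' := fun y x => R x y.
have RE x y : R x y = t_meet t x y by [].
have RE' y x : R' y x = t_meet t y x by rewrite /R' /R /t_meet capvC.
have abn' : b + a < \dim {:V} + t by rewrite addnC.
apply: (fragment_singleton amax).
- exact: grassmannian_transitive RE.
- exact: grassmannian_transitive RE'.
- by apply: (grassmannian_primitive RE).
- by apply: (grassmannian_primitive RE').
- by apply: (t_meet_fails RE').
- by apply: (t_meet_fails RE).
- by apply: (t_meet_second_separator RE).
- by apply: (t_meet_second_separator RE').
- by apply: (no_two_line_structure RE).
- by apply: (no_two_line_structure RE').
Qed.

End Transfer.

Local Open Scope ring_scope.

Theorem theorem1p3 (F : finFieldType) (V : vectType F) (q n a b t : nat)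
    (cA cB : {set {vspace V}}) :
  #|F| = q -> \dim {:V} = n ->
  (0 < a)%N -> (0 < b)%N -> (0 < t)%N ->
  (4 <= n)%N -> (2 <= a)%N -> (2 <= b)%N ->
  (t < minn a b)%N -> (a + b < n + t)%N ->
  gauss_binom q n a <= gauss_binom q n b ->
  cA \subset subspaces V a -> cB \subset subspaces V b ->
  cA != set0 -> cB != set0 ->
  cross_intersecting t cA cB ->
  let bound : rat :=
    gauss_binom q n b
    - \sum_(0 <= i < t) q%:R ^+ ((a - i) * (b - i))
        * gauss_binom q a i * gauss_binom q (n - a) (b - i)
    + 1 in
  #|cA|%:R + #|cB|%:R <= bound
  /\ (#|cA|%:R + #|cB|%:R = bound <->
      (exists A : {vspace V}, A \in subspaces V a /\
         cA = [set A] /\ cB = subspaces V b :\: nbhd t b A)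
      \/
      (gauss_binom q n a = gauss_binom q n b /\
       exists B : {vspace V}, B \in subspaces V b /\
         cA = subspaces V a :\: nbhd t a B /\ cB = [set B])).
Proof.
move=> Fq Vn _ _ t0 _ _ _; rewrite leq_min => /andP[ta tb] abn ab.
move=> sA sB A0 B0 AB bound.
subst q n.
pose R := @t_meet F V t a b; pose R' := fun y x => R x y.
have RE x y : R x y = t_meet t x y by [].
have RE' y x : R' y x = t_meet t y x by rewrite /R' /R /t_meet capvC.
have tX : transitive_aut R := grassmannian_transitive RE.
have tY : transitive_aut R' := grassmannian_transitive RE'.
pose A := [set x : grassmannian V a | val x \in cA].
pose B := [set y : grassmannian V b | val y \in cB].
have eA : [set val x | x in A] = cA := val_pullback sA.
have eB : [set val y | y in B] = cB := val_pullback sB.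
have valF (x : grassmannian V a) :
    [set val y | y in nbrs_of R' x] = subspaces V b :\: nbhd t b (val x).
  exact: val_nbrs.
have valG (y : grassmannian V b) :
    [set val x | x in nbrs_of R y] = subspaces V a :\: nbhd t a (val y).
  by rewrite -val_nbrs; congr [set val x | x in pred_of_set _]; apply/setP=> x; rewrite !inE RE /t_meet capvC.
(* The stated bound is one more than the common degree of the vertices of dimension [a]. *)
have cF x : #|nbrs_of R' x|%:R + 1 = bound.
  rewrite -(card_imset _ val_inj) valF card_nonnbhd //; exact: ltnW.
have A0' : A != set0 by apply: contra A0 => /eqP e; rewrite -eA e imset0.
have B0' : B != set0 by apply: contra B0 => /eqP e; rewrite -eB e imset0.
have [x0 x0A] := set0Pn _ A0'; have [y0 y0B] := set0Pn _ B0'.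
have fE x : #|nbrs_of R' x| = #|nbrs_of R' x0| by apply: (@card_nbrs_const _ _ R' _ _ tX).
have XY : (#|grassmannian V a| <= #|grassmannian V b|)%N.
  by rewrite !card_grassmannian -(ler_nat rat) !card_subspaces.
have gE : #|grassmannian V a| = #|grassmannian V b| <->
    gauss_binom #|F| (\dim {:V}) a = gauss_binom #|F| (\dim {:V}) b.
  rewrite !card_grassmannian -!card_subspaces; split=> [->//|/eqP].
  by rewrite eqr_nat => /eqP.
have AB' x y : x \in A -> y \in B -> R x y by rewrite !inE; apply: AB.
have [le eq] := cross_bound tX tY
  (fun alpha amax P => @t_meet_fragment F V t a b alpha P t0 ta tb abn amax)
  XY fE A0' B0' AB'.
rewrite -eA -eB !(card_imset _ val_inj) -natrD -(cF x0) -[1]/(1%:R) -natrD ler_nat.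
split=> //; split.
  move/eqP; rewrite eqr_nat => /eqP/eq[[x [-> ->]]|[eXY [y [-> ->]]]].
    by left; exists (val x); rewrite inE dim_val eqxx imset_set1 valF.
  right; split; first exact/gE.
  by exists (val y); rewrite inE dim_val eqxx imset_set1 valG.
move=> h; congr _%:R; rewrite -(card_imset A val_inj) -(card_imset B val_inj) eA eB.
move: h; rewrite eA eB => -[[U [/[!inE]/eqP dU [-> ->]]]|[/gE eXY [U [/[!inE]/eqP dU [-> ->]]]]].
  have [x <-] := grassmannian_of dU.
  by rewrite -valF (card_imset _ val_inj) cards1 fE addnC.
have [y <-] := grassmannian_of dU; rewrite -valG (card_imset _ val_inj) cards1.
(* Sides of equal size have equal degrees, by counting edges from both sides. *)
congr (_ + _)%N; apply/eqP.
have X0 : (0 < #|grassmannian V a|)%N by apply/card_gt0P; exists x0.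
by rewrite -(eqn_pmul2l X0) {1}eXY -(graph_double_count x0 y tX tY).
Qed.
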